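(* Let $\mathcal{H}_k$ be an admissible reproducing kernel Hilbert space on a set $X$ with the diagonal complete Pick property, and let $\mathcal{M}_k$ be its multiplier algebra. Then the Bohr set of $\mathcal{M}_k$ is \[\mathcal{B}(\mathcal{M}_k) = \left\{ x \in X \,:\, k(x,x) \leq \frac{9}{8} \right\}.\]
   Context: All Hilbert spaces are complex. Let $X$ be a set and let $\mathcal{H}_k$ be a reproducing kernel Hilbert space of functions on $X$ with reproducing kernel $k : X\times X\to\mathbb{C}$. Admissible: $\mathcal{H}_k$ is admissible if there is a countable abelian semigroup $(\Lambda,+)$ with identity $0$ and an orthogonal basis $\{e_\lambda\}_{\lambda\in\Lambda}$ for $\mathcal{H}_k$ satisfying $e_0\equiv 1$ and $e_\lambda e_\mu = e_{\lambda+\mu}$ for all $\lambda,\mu\in\Lambda$, and if there is a point $x_0\in X$ such that $k(x,x_0)= 1$ for every $x\in X$. (The basis is orthogonal but not necessarily normalized.) Every $f\in\mathcal{H}_k$ has a unique expansion $f=\sum_{\lambda\in\Lambda}\widehat{f}(\lambda)e_\lambda$, which converges in $\mathcal{H}_k$ and absolutely at every point of $X$. Diagonal complete Pick property: an admissible space $\mathcal{H}_k$ has this property if $k\not\equiv 1$ and $k = 1+\kappa k$ (pointwise on $X\times X$) for a kernel of the form \[\kappa(x,y)=\sum_{\lambda\neq 0} c_\lambda e_\lambda(x)\overline{e_\lambda(y)}\] with $c_\lambda\ge 0$ for every $\lambda\in\Lambda\setminus\{0\}$ (the series being absolutely convergent on $X\times X$). Multiplier algebra: $\mathcal{M}_k$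 consists of the functions $\varphi$ on $X$ such that $f\mapsto\varphi f$ defines a bounded linear operator $M_\varphi$ on $\mathcal{H}_k$, with norm $\|\varphi\|_{\mathcal{M}_k}=\|M_\varphi\|$. Since $e_0\equiv1\in\mathcal{H}_k$, one has $\mathcal{M}_k\subseteq\mathcal{H}_k$, so the coefficients $\widehat{\varphi}(\lambda)$ are defined for $\varphi\in\mathcal{M}_k$. Majorant and Bohr set: for $\varphi\in\mathcal{M}_k$ and $x\in X$, $M\varphi(x)=\sum_{\lambda\in\Lambda}|\widehat{\varphi}(\lambda)e_\lambda(x)|$, and \[\mathcal{B}(\mathcal{M}_k)=\{x\in X : M\varphi(x)\le\|\varphi\|_{\mathcal{M}_k}\text{ for every }\varphi\in\mathcal{M}_k\}.\] *)

(* Defs.v *)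
From HB Require Import structures.
From mathcomp Require Import all_boot all_order all_algebra finmap.
From mathcomp Require Import sesquilinear complex.
From mathcomp Require Import all_classical all_reals all_analysis.
From mathcomp Require Import summability.

Set Implicit Arguments.
Unset Strict Implicit.
Unset Printing Implicit Defensive.

Import Order.TTheory GRing.Theory Num.Theory.
Import numFieldNormedType.Exports.

Local Open Scope classical_set_scope.
Local Open Scope complex_scope.
Local Open Scope ring_scope.

(* Norms over [R[i]] are nonnegative elements of [R[i]]; [rnorm] is the same
   norm as a real number. *)
Definition rnorm (R : realType) (V : normedZmodType R[i]) (v : V) : R :=
  complex.Re `|v|.

(* Unconditional sum, as the limit of the net of finite partial sums, of the
   family [f] over the indices satisfying [P]. *)
Definition has_sum (K : numFieldType) (V : normedModType K) (I : choiceType)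
    (P : pred I) (f : I -> V) (s : V) : Prop :=
  (fun A : {fset I} => \sum_(i <- A | P i) f i) @ totally --> s.

(* The elements of the Hilbert space are identified with functions on [X]
   through the injective linear map [rk_eval]. The inner product
   is linear in its first argument, and [rk_dot f f] is the square of the norm,
   so that completeness of [rk_space] is that of the inner product. *)
Record rkhs (R : realType) (X : Type) := RKHS {
  rk_space :> completeNormedModType R[i];
  rk_dot : {dot rk_space for Num.conj};
  rk_normE : forall f : rk_space, `|f| ^+ 2 = rk_dot f f;
  rk_eval : {linear rk_space -> (X -> R[i]^o)};
  rk_eval_inj : injective rk_eval;
  rk_kernel : X -> X -> R[i];
  rk_reproducing : forall y, exists2 ky : rk_space,
    rk_eval ky = rk_kernel ^~ y &
    forall f : rk_space, rk_dot f ky = rk_eval f y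
}.

Section Definitions.
Variables (R : realType) (X : Type) (H : rkhs R X).
Local Notation C := R[i].
Local Notation ev := (@rk_eval R X H).
Local Notation k := (@rk_kernel R X H).

Section Basis.
Variables (L : countNmodType) (e : L -> H).

Definition orthogonal_basis : Prop :=
  [/\ forall l, e l != 0,
      forall l m, l != m -> rk_dot H (e l) (e m) = 0 &
      dense [set f : H | exists (A : {fset L}) (a : L -> C),
                           f = \sum_(l <- A) a l *: e l]].

(* Countable abelian semigroups with identity are exactly the inhabitants of
   [countNmodType]. *)
Definition admissible : Prop :=
  [/\ orthogonal_basis,
      forall x, ev (e 0) x = 1,
      forall l m x, ev (e l) x * ev (e m) x = ev (e (l + m)) x &
      exists x0, forall x, k x x0 = 1].

Definition diagonal_complete_pick : Prop :=
  (exists x y, k x y != 1) /\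
  exists (kappa : X -> X -> C) (c : L -> R),
    (forall l, l != 0 -> 0 <= c l) /\
    forall x y,
      let term (l : L) : C^o := (c l)%:C * ev (e l) x * (ev (e l) y)^* in
      [/\ (\esum_(l in [set l : L | l != 0%R]) (rnorm (term l))%:E < +oo)%E,
          has_sum (fun l => l != 0) term (kappa x y) &
          k x y = 1 + kappa x y * k x y].

(* The coefficient family of the expansion, in the norm of [H], of the function
   [phi] along [e]; it is relevant only when [phi] belongs to [H]. *)
Definition coef (phi : X -> C) : L -> C :=
  xget (fun=> 0) [set a | exists2 f : H, ev f = phi &
                            has_sum predT (fun l => a l *: e l) f].

Definition majorant (phi : X -> C) (x : X) : \bar R :=
  (\esum_(l in [set: L]) (rnorm (coef phi l * ev (e l) x)%R)%:E)%E.

End Basis.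

(* [mulop phi f] is the element of [H] representing the function
   [phi * f] when there is one, and [0] otherwise. *)
Definition mulop (phi : X -> C) (f : H) : H :=
  xget 0 [set g : H | ev g = (fun x => phi x * ev f x)].

Definition multiplier (phi : X -> C) : Prop :=
  (forall f, ev (mulop phi f) = (fun x => phi x * ev f x)) /\
  exists B : R, forall f, rnorm (mulop phi f) <= B * rnorm f.

Definition multiplier_norm (phi : X -> C) : R :=
  sup [set rnorm (mulop phi f) | f in [set f : H | rnorm f <= 1]].

Definition bohr_set (L : countNmodType) (e : L -> H) : set X :=
  [set x | forall phi : X -> C, multiplier phi ->
             (majorant e phi x <= (multiplier_norm phi)%:E)%E].

End Definitions.

(* Main.v *)
(* Write a_l = 1/|e_l|^2 and let T_l be multiplication by sqrt(c_l) e_l.  The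
   identity k = 1 + kappa k says that (T_l)_l is a row contraction, and more
   precisely |f|^2 = |<f,1>|^2 + sum_l |T_l^* f|^2.

   Let M be multiplication by phi, with |M| <= B, and let
   q(f) = B^2 |f|^2 - |M^* f|^2.  As M^* commutes with the T_l^*, for f
   orthogonal to 1 one gets q(f) + |<phi,f>|^2 = sum_l q(T_l^* f), while the
   Cauchy-Schwarz inequality for q against the constant 1 gives
   B^2 |<phi,f>|^2 <= s^2 sum_l q(T_l^* f) where s^2 = B^2 - |phi(x0)|^2.  The
   class of all f with |<f,e_m>| <= t |e_m(x)| for every m is mapped by T_l^* into
   the same class with t sqrt(c_l) |e_l(x)| in place of t.  If
   kappa(x,x) <= 1/9, iterating these relations bounds sqrt(q(f)) by 3/2 t s on
   this class, hence B |<phi, f - <f,1>>| <= s^2/2 for t = 1.  The choice of f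
   whose moments have modulus |e_m(x)| and the phases of the coefficients of phi
   turns <f,phi> into the majorant at x, which is then at most
   |phi(x0)| + (B^2 - |phi(x0)|^2)/(2 B) <= B.

   Conversely, if r^2 = kappa(x,x) > 1/9, then psi = kappa(.,x)/r is a
   contractive multiplier with psi(x0) = 0 and psi(x) = r, and the multiplier
   (t - psi)/(1 - t psi) violates the inequality at x for t close to 1.  No
   computation of coefficients is needed there: the majorant at x is at least
   |phi(x0)| + |phi(x) - phi(x0)|. *)
From HB Require Import structures.
From mathcomp Require Import all_boot all_order all_algebra finmap.
From mathcomp Require Import sesquilinear complex.
From mathcomp Require Import all_classical all_reals all_analysis.
From mathcomp Require Import summability.
From mathcomp Require Import ring lra.
Require Import Defs.

Set Implicit Arguments.
Unset Strict Implicit.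
Unset Printing Implicit Defensive.

Import Order.TTheory GRing.Theory Num.Theory.
Import numFieldNormedType.Exports.

Local Open Scope classical_set_scope.
Local Open Scope complex_scope.
Local Open Scope ring_scope.

#[local] Existing Instance totally_filter.

(** * Norms, inner products and unconditional sums *)

Section RealNorm.
Variable R : realType.
Local Notation C := R[i].

Lemma rnormE (V : normedZmodType C) (v : V) : `|v| = (rnorm v)%:C.
Proof. by rewrite /rnorm RRe_real// ger0_real. Qed.

Lemma rnorm_ge0 (V : normedZmodType C) (v : V) : 0 <= rnorm v.
Proof. by rewrite -lecR -rnormE normr_ge0. Qed.

Lemma rnorm0 {V : normedZmodType C} : rnorm (0 : V) = 0.
Proof. by rewrite /rnorm normr0. Qed.

Lemma rnormN (V : normedZmodType C) (v : V) : rnorm (- v) = rnorm v.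
Proof. by rewrite /rnorm normrN. Qed.

Lemma rnormD (V : normedZmodType C) (u v : V) :
  rnorm (u + v) <= rnorm u + rnorm v.
Proof. by rewrite -lecR rmorphD/= -!rnormE ler_normD. Qed.

Lemma rnorm_eq0 (V : normedZmodType C) (v : V) : (rnorm v == 0) = (v == 0).
Proof. by rewrite -[RHS]normr_eq0 rnormE (inj_eq (@complexI R)). Qed.

Lemma rnormZ (V : normedModType C) (z : C) (v : V) :
  rnorm (z *: v) = rnorm z * rnorm v.
Proof. by apply: complexI; rewrite -rnormE normrZ !rnormE -rmorphM. Qed.

Lemma rnormM (y z : C) : rnorm (y * z) = rnorm y * rnorm z.
Proof. by apply: complexI; rewrite -rnormE normrM !rnormE -rmorphM. Qed.

Lemma rnormJ (z : C) : rnorm z^* = rnorm z.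
Proof. by apply: complexI; rewrite -!rnormE normcJ. Qed.

Lemma rnorm_real (t : R) : rnorm (t%:C : C) = `|t|.
Proof. by apply: complexI; rewrite -rnormE normc_def/= expr0n/= addr0 sqrtr_sqr. Qed.

Lemma conjCR (t : R) : (t%:C : C)^* = t%:C.
Proof. exact: conjc_real. Qed.

Lemma conjCM (y z : C) : (y * z)^* = y^* * z^*.
Proof. exact: rmorphM. Qed.

Lemma conjC_involutive (z : C) : (z^*)^* = z.
Proof. exact: conjcK. Qed.

Lemma mul_conjC_rnorm (z : C) : z * z^* = (rnorm z ^+ 2)%:C.
Proof. by rewrite -sqr_normc rnormE rmorphXn. Qed.

Lemma rnorm_sqrE (z : C) :
  rnorm z ^+ 2 = complex.Re z ^+ 2 + complex.Im z ^+ 2.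
Proof.
apply: complexI; rewrite -[LHS]mul_conjC_rnorm.
by rewrite -[RHS]/((complex.Re z ^+ 2 + complex.Im z ^+ 2)%:C) add_Re2_Im2 sqr_normc.
Qed.

Lemma rnorm_parallelogram (x y : C) : rnorm (x + y) ^+ 2 + rnorm (x - y) ^+ 2 =
  2 * rnorm x ^+ 2 + 2 * rnorm y ^+ 2.
Proof. by rewrite !rnorm_sqrE !raddfD !raddfN /=; ring. Qed.

Lemma le_Re_rnorm (z : C) : complex.Re z <= rnorm z.
Proof.
rewrite -lecR -rnormE; apply: le_trans (normc_ge_Re z).
by rewrite lecR ler_norm.
Qed.

Lemma has_sumP (V : normedModType C) (I : choiceType) (P : pred I) (f : I -> V)
    (s : V) :
  has_sum P f s <-> forall eps : R, 0 < eps -> exists A0 : {fset I},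
    forall A, (A0 `<=` A)%fset -> rnorm (s - \sum_(i <- A | P i) f i) < eps.
Proof.
rewrite /has_sum; split.
  move/cvgrPdist_lt => h eps eps0.
  have epsC : 0 < eps%:C :> C by rewrite ltcR.
  have [A0 _ hA0] := h _ epsC.
  by exists A0 => A /hA0/=; rewrite rnormE ltcR.
move=> h; apply/cvgrPdist_lt => eps eps0.
have epsE : eps = (complex.Re eps)%:C by rewrite RRe_real// gtr0_real.
have /h[A0 hA0] : 0 < complex.Re eps by rewrite -ltcR -epsE.
by exists A0 => // A /= /hA0; rewrite epsE rnormE ltcR.
Qed.

(** A finite set [A0] whose [w]-sum is within [eps ^ 2] of the supremum leaves only tails of norm
    below [eps], so the net of partial sums is Cauchy and completeness gives the limit. *)
Lemma has_sum_sqr_le (V : completeNormedModType C) (I : choiceType) (f : I -> V)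
    (w : I -> R) (W : R) :
  (forall i, 0 <= w i) -> (forall A : {fset I}, \sum_(i <- A) w i <= W) ->
  (forall A : {fset I}, rnorm (\sum_(i <- A) f i) ^+ 2 <= \sum_(i <- A) w i) ->
  exists s, has_sum predT f s.
Proof.
move=> w0 wW fw.
pose E := [set \sum_(i <- A) w i | A in [set: {fset I}]].
have supE : has_sup E.
  split; first by exists (\sum_(i <- fset0) w i); exists fset0.
  by exists W => _ [A _ <-].
have c : cauchy ((fun A : {fset I} => \sum_(i <- A) f i) @ totally).
  apply/cauchyP => eps eps0.
  have epsE : eps = (complex.Re eps)%:C by rewrite RRe_real// gtr0_real.
  have e0 : 0 < complex.Re eps by rewrite -ltcR -epsE.
  have [_ [A0 _ <-] hA0] := sup_adherent (exprn_gt0 2 e0) supE.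
  exists (\sum_(i <- A0) f i); exists A0 => // A /= A0A.
  rewrite -ball_normE/= distrC rnormE epsE ltcR.
  have AE (V' : nmodType) (g : I -> V') : \sum_(i <- A) g i =
      \sum_(i <- A0) g i + \sum_(i <- (A `\` A0)%fset) g i.
    rewrite -big_cat/=; apply: perm_big; apply: uniq_perm => //=.
      rewrite cat_uniq !fset_uniq/= andbT; apply/hasPn => i.
      by rewrite in_fsetD => /andP[].
    move=> i; rewrite mem_cat in_fsetD; case: (boolP (i \in A0)) => //= iA0.
    exact: (fsubsetP A0A).
  rewrite AE addrC addKr -(@ltr_pXn2r _ 2) ?nnegrE ?rnorm_ge0 ?(ltW e0)//.
  apply: le_lt_trans (fw _) _.
  have : \sum_(i <- A) w i <= sup E by apply: ub_le_sup; [case: supE|exists A].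
  rewrite AE; move: hA0; rewrite ltrBlDr => hA0 /le_lt_trans /(_ hA0).
  by rewrite ltrD2l.
exists (lim ((fun A : {fset I} => \sum_(i <- A) f i) @ totally)).
exact: cauchy_cvg.
Qed.

End RealNorm.

Arguments rnorm0 {R V}.

Section Esum.
Variables (R : realType) (I : choiceType).

Lemma esum_le_fset (f : I -> R) (W : R) :
  (forall A : {fset I}, \sum_(i <- A) f i <= W) ->
  (\esum_(i in [set: I]) (f i)%:E <= W%:E)%E.
Proof.
move=> fW; apply: ge_ereal_sup => _ [X [finX _] <-].
by rewrite fsbig_finite//= sumEFin lee_fin.
Qed.

Lemma fset_le_esum (f : I -> R) (A : {fset I}) :
  ((\sum_(i <- A) f i)%:E <= \esum_(i in [set: I]) (f i)%:E)%E.
Proof.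
apply: esum_ge; exists [set` A]; first by split => //; exact: finite_fset.
by rewrite fsbig_finite ?set_fsetK ?sumEFin//; exact: finite_fset.
Qed.

Lemma term_le_esum (f : I -> R) (i : I) :
  ((f i)%:E <= \esum_(i in [set: I]) (f i)%:E)%E.
Proof. by have := fset_le_esum f [fset i]%fset; rewrite big_seq_fset1. Qed.

End Esum.

Lemma realCD (R : realType) (x y : R) : (x + y)%:C = x%:C + y%:C :> R[i].
Proof. exact: rmorphD. Qed.

Lemma realCM (R : realType) (x y : R) : (x * y)%:C = x%:C * y%:C :> R[i].
Proof. exact: rmorphM. Qed.

Lemma Re2_add_conjC (R : realType) (z : R[i]) :
  (2 * complex.Re z)%:C = z + z^*.
Proof.
by rewrite rmorphM rmorphMn/= rmorph1; apply: esym; exact: addcJ.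
Qed.

(** * Geometry of an inner product *)

Section InnerProduct.
Variables (R : realType) (V : completeNormedModType R[i]).
Variable dt : {dot V for Num.conj}.
Hypothesis dtE : forall u : V, `|u| ^+ 2 = dt u u.
Local Notation C := R[i].

Lemma dot_rnorm u : dt u u = (rnorm u ^+ 2)%:C.
Proof. by rewrite -dtE rnormE rmorphXn. Qed.

Lemma dotC u v : dt u v = (dt v u)^*.
Proof.
rewrite (@hermC _ false (Num.conj : {rmorphism C -> C}) _ dt u v).
by rewrite expr0 mul1r.
Qed.

Lemma dotZl (z : C) u v : dt (z *: u) v = z * dt u v.
Proof. exact: linearZl_LR. Qed.

Lemma dotZr (z : C) u v : dt u (z *: v) = z^* * dt u v.
Proof. exact: linearZr_LR. Qed.

Lemma dotDl u v w : dt (u + v) w = dt u w + dt v w.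
Proof. exact: linearDl. Qed.

Lemma dotDr u v w : dt u (v + w) = dt u v + dt u w.
Proof. exact: linearDr. Qed.

Lemma dotNl u v : dt (- u) v = - dt u v.
Proof. exact: linearNl. Qed.

Lemma dotNr u v : dt u (- v) = - dt u v.
Proof. exact: linearNr. Qed.

Lemma dotBl u v w : dt (u - v) w = dt u w - dt v w.
Proof. by rewrite dotDl dotNl. Qed.

Lemma dotBr u v w : dt u (v - w) = dt u v - dt u w.
Proof. by rewrite dotDr dotNr. Qed.

Lemma dot0l u : dt 0 u = 0. Proof. exact: linear0l. Qed.
Lemma dot0r u : dt u 0 = 0. Proof. exact: linear0r. Qed.

Lemma dot_suml (I : Type) (r : seq I) (P : pred I) (F : I -> V) v :
  dt (\sum_(i <- r | P i) F i) v = \sum_(i <- r | P i) dt (F i) v.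
Proof. by elim/big_rec2 : _ => [|i y x Pi <-]; rewrite ?dot0l ?dotDl. Qed.

Lemma dot_sumr (I : Type) (r : seq I) (P : pred I) (F : I -> V) v :
  dt v (\sum_(i <- r | P i) F i) = \sum_(i <- r | P i) dt v (F i).
Proof. by elim/big_rec2 : _ => [|i y x Pi <-]; rewrite ?dot0r ?dotDr. Qed.

Lemma rnormDsqr (u v : V) :
  rnorm (u + v) ^+ 2 = rnorm u ^+ 2 + rnorm v ^+ 2 + 2 * complex.Re (dt u v).
Proof.
apply: complexI; rewrite -dot_rnorm dotDl !dotDr (dotC v u) !dot_rnorm.
by rewrite !realCD Re2_add_conjC; ring.
Qed.

Lemma rnormBsqr (u v : V) :
  rnorm (u - v) ^+ 2 = rnorm u ^+ 2 + rnorm v ^+ 2 - 2 * complex.Re (dt u v).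
Proof. by rewrite rnormDsqr rnormN dotNr raddfN mulrN. Qed.

Lemma parallelogram (u v : V) : rnorm (u + v) ^+ 2 + rnorm (u - v) ^+ 2 =
  2 * rnorm u ^+ 2 + 2 * rnorm v ^+ 2.
Proof. rewrite rnormDsqr rnormBsqr; lra. Qed.

Lemma dot_cauchy_schwarz (u v : V) : rnorm (dt u v) <= rnorm u * rnorm v.
Proof.
have [->|v0] := eqVneq v 0; first by rewrite dot0r !rnorm0 mulr0.
have nv0 : 0 < rnorm v by rewrite lt_def rnorm_ge0 rnorm_eq0 v0.
pose al : C := dt u v / (rnorm v ^+ 2)%:C.
have nv0C : (rnorm v ^+ 2)%:C != 0 :> C.
  by rewrite (inj_eq (@complexI R) _ 0) expf_neq0// gt_eqF.
have uE : u = (u - al *: v) + al *: v by rewrite subrK.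
have o : dt (u - al *: v) (al *: v) = 0.
  by rewrite dotZr dotBl dotZl dot_rnorm divfK// subrr mulr0.
have := congr1 (fun w => rnorm w ^+ 2) uE; rewrite /= rnormDsqr o mulr0 addr0.
rewrite rnormZ => h.
rewrite -(@ler_pXn2r _ 2)// ?nnegrE ?mulr_ge0 ?rnorm_ge0//.
have -> : rnorm (dt u v) = rnorm al * rnorm v ^+ 2.
  rewrite -[rnorm v ^+ 2]ger0_norm ?sqr_ge0// -(rnorm_real (rnorm v ^+ 2)).
  by rewrite -rnormM divfK.
rewrite [leRHS]exprMn h; have := sqr_ge0 (rnorm (u - al *: v)).
by have := sqr_ge0 (rnorm v); nra.
Qed.

(** Pairing with [v] is continuous, and here it is constant on the partial sums over sets containing
    [A1]. This is how the moments of an infinite sum are read off. *)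
Lemma dot_cvg (I : choiceType) (f : I -> V) s v (z : C) (A1 : {fset I}) :
  has_sum predT f s ->
  (forall A : {fset I}, (A1 `<=` A)%fset -> dt (\sum_(i <- A) f i) v = z) ->
  dt s v = z.
Proof.
move=> /has_sumP fs fz; apply/eqP; rewrite -subr_eq0 -rnorm_eq0 eq_le rnorm_ge0.
rewrite andbT; apply/ler_addgt0Pr => eps eps0; rewrite add0r.
have d0 : 0 < eps / (rnorm v + 1) by rewrite divr_gt0// ltr_wpDl// rnorm_ge0.
have [A0 hA0] := fs _ d0.
rewrite -(fz (A0 `|` A1)%fset) ?fsubsetUr// -dotBl.
apply: le_trans (dot_cauchy_schwarz _ _) _.
have := hA0 (A0 `|` A1)%fset (fsubsetUl _ _).
rewrite ltr_pdivlMr ?ltr_wpDl// ?rnorm_ge0// => /ltW; apply: le_trans.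
by rewrite ler_wpM2l// ?rnorm_ge0// lerDl.
Qed.

Lemma has_sum_rnorm_le (I : choiceType) (f : I -> V) s (B : R) :
  has_sum predT f s ->
  (forall A : {fset I}, rnorm (\sum_(i <- A) f i) <= B) -> rnorm s <= B.
Proof.
move=> /has_sumP fs fB; apply/ler_addgt0Pr => eps /fs[A hA].
have := hA _ (fsubset_refl A); set t := \sum_(_ <- _ | _) _ => h.
rewrite -(subrK t s) addrC; apply: le_trans (rnormD _ _) _.
by rewrite lerD// ?fB// ltW.
Qed.

End InnerProduct.

(** * Density of subspaces with trivial orthogonal complement *)

Section Span.
Variables (R : realType) (V : completeNormedModType R[i]).
Variable dt : {dot V for Num.conj}.
Hypothesis dtE : forall u : V, `|u| ^+ 2 = dt u u.
Local Notation C := R[i].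
Variable D : set V.
Hypotheses (D0 : D 0) (DP : forall (z : C) u v, D u -> D v -> D (z *: u + v)).

(** The best competitor along [w] is [v + al w]. It lowers the squared distance to [f] by
    [|<f - v, w>|^2 / |w|^2], and a [v] within [eta] of the lower bound [d] leaves room for a drop
    of at most [eta]. *)
Lemma near_projection (f v w : V) (d eta : R) :
  (forall v, D v -> d <= rnorm (f - v) ^+ 2) -> D v -> D w ->
  rnorm (f - v) ^+ 2 <= d + eta -> rnorm (dt (f - v) w) ^+ 2 <= eta * rnorm w ^+ 2.
Proof.
move=> df Dv Dw fv.
have [->|w0] := eqVneq w 0; first by rewrite dot0r !rnorm0 expr0n/= mulr0.
have nw0 : 0 < rnorm w ^+ 2.
  by rewrite exprn_gt0// lt_def rnorm_ge0 rnorm_eq0 w0.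
set g := f - v in fv *.
pose al : C := dt g w * ((rnorm w ^+ 2)^-1)%:C.
have := df _ (DP al Dw Dv).
have -> : f - (al *: w + v) = g - al *: w by rewrite /g opprD addrCA addrC.
rewrite (rnormBsqr dtE) rnormZ dotZr.
have -> : complex.Re (al^* * dt g w) = rnorm (dt g w) ^+ 2 / rnorm w ^+ 2.
  rewrite /al rmorphM/= (_ : ((rnorm w ^+ 2)^-1)%:C^* = ((rnorm w ^+ 2)^-1)%:C).
    rewrite mulrAC [_^* * _]mulrC mul_conjC_rnorm -realCM//.
  by rewrite conj_Creal// complex_real.
rewrite /al rnormM rnorm_real ger0_norm ?invr_ge0 ?sqr_ge0//.
move=> h.
set t := rnorm (dt g w) in h *; set s := rnorm w ^+ 2 in h nw0 *.
have hE : (t * s^-1 * rnorm w) ^+ 2 = t ^+ 2 / s.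
  by rewrite !exprMn -/s; field; rewrite gt_eqF.
rewrite hE in h; rewrite -ler_pdivrMr//; lra.
Qed.

(** Projection onto the closure of [D]: a minimizing sequence for the distance to [f] is Cauchy, and
    the residual at its limit [h] is orthogonal to [D], hence zero. *)
Lemma ortho_eq0_dense : (forall u, (forall v, D v -> dt u v = 0) -> u = 0) ->
  forall f (eps : R), 0 < eps -> exists2 v, D v & rnorm (f - v) < eps.
Proof.
move=> oD f eps eps0.
pose E := [set rnorm (f - v) ^+ 2 | v in D].
have infE : has_inf E.
  split; first by exists (rnorm (f - 0) ^+ 2); exists 0.
  by exists 0 => _ [v _ <-]; exact: sqr_ge0.
have dE v : D v -> inf E <= rnorm (f - v) ^+ 2.
  by move=> Dv; apply: ge_inf; [case: infE|exists v].
have /choice[v hv] (n : nat) : exists v, D v /\ rnorm (f - v) ^+ 2 <= inf E + n.+1%:R^-1.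
  have n0 : 0 < n.+1%:R^-1 :> R by rewrite invr_gt0.
  by have [_ [v Dv <-] /ltW] := inf_adherent n0 infE; exists v.
(* Parallelogram law for [f - v m] and [f - v n]: the midpoint of [v m] and [v n] lies in [D], so
   its squared distance to [f] is at least [inf E]. *)
have vv m n : rnorm (v m - v n) ^+ 2 <= 2 * m.+1%:R^-1 + 2 * n.+1%:R^-1.
  have [[Dm hm] [Dn hn]] := (hv m, hv n).
  have := parallelogram dtE (f - v m) (f - v n).
  have -> : f - v m - (f - v n) = - (v m - v n).
    by rewrite !opprB addrC addrA subrK.
  rewrite rnormN.
  have -> : f - v m + (f - v n) = 2%:R *: (f - (2^-1 *: v m + 2^-1 *: v n)).
    rewrite scalerBr scalerDr !scalerA divff ?pnatr_eq0// !scale1r scaler_nat.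
    by rewrite mulr2n opprD addrACA.
  have Dmn : D (2^-1 *: v m + 2^-1 *: v n).
    apply: DP => //; rewrite -[_ *: _]addr0; exact: DP.
  have := dE _ Dmn.
  have -> (w : V) : rnorm (2%:R *: w) ^+ 2 = 4%:R * rnorm w ^+ 2.
    have -> : (2%:R : C) = (2%:R : R)%:C by rewrite rmorph_nat.
    by rewrite rnormZ rnorm_real exprMn ger0_norm// -natrX.
  have gen (a b c x i p q : R) : a <= i + p -> b <= i + q -> i <= c ->
    4%:R * c + x = 2 * a + 2 * b -> x <= 2 * p + 2 * q by lra.
  exact: gen hm hn.
have small (r : R) : 0 < r -> exists n : nat, forall m, (n <= m)%N -> m.+1%:R^-1 < r.
  move=> r0; exists (Num.truncn r^-1) => m nm.
  rewrite invf_plt ?posrE//; apply: lt_le_trans (truncnS_gt _) _.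
  by rewrite ler_nat.
have c : cauchy (v @ \oo).
  apply/cauchyP => e e0.
  have eE : e = (complex.Re e)%:C by rewrite RRe_real// gtr0_real.
  have e0' : 0 < complex.Re e by rewrite -ltcR -eE.
  have e40 : 0 < complex.Re e ^+ 2 / 4%:R by rewrite divr_gt0// exprn_gt0.
  have [N hN] := small _ e40.
  exists (v N); exists N => // n /= Nn.
  rewrite -ball_normE/= rnormE eE ltcR -(@ltr_pXn2r _ 2) ?nnegrE ?rnorm_ge0 ?(ltW e0')//.
  apply: le_lt_trans (vv _ _) _.
  have gen (p q r : R) : p < r / 4%:R -> q < r / 4%:R -> 2 * p + 2 * q < r by lra.
  exact: gen (hN _ (leqnn N)) (hN _ Nn).
have /cvgrPdist_lt vh : v @ \oo --> lim (v @ \oo) by exact: cauchy_cvg.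
set h := lim _ in vh.
have {}vh (r : R) : 0 < r -> exists n : nat, forall m, (n <= m)%N -> rnorm (h - v m) < r.
  move=> r0; have r0C : 0 < r%:C :> C by rewrite ltcR.
  have [n _ hn] := vh _ r0C.
  by exists n => m /hn/=; rewrite rnormE ltcR.
suff fh : f - h = 0.
  have [n hn] := vh _ eps0; exists (v n); first by case: (hv n).
  by move/eqP: fh; rewrite subr_eq0 => /eqP ->; exact: hn.
apply: oD => w Dw; apply/eqP; rewrite -rnorm_eq0 eq_le rnorm_ge0 andbT.
apply/ler_addgt0Pr => e e0; rewrite add0r.
have W0 : 0 < rnorm w + 1 by rewrite ltr_wpDl// rnorm_ge0.
have r0 : 0 < e / 2 / (rnorm w + 1) by rewrite !divr_gt0.
have [n1 h1] := vh _ r0; have [n2 h2] := small _ (exprn_gt0 2 r0).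
pose n := maxn n1 n2.
have {}h1 := h1 n (leq_maxl _ _); have {}h2 := h2 n (leq_maxr _ _).
(* [f - v n] is nearly orthogonal to [w] and [h - v n] is small; each part contributes at most
   [e / 2]. *)
have -> : f - h = (f - v n) - (h - v n) by rewrite opprB addrA subrK.
rewrite dotBl; apply: le_trans (rnormD _ _) _; rewrite rnormN.
have [Dn hn] := hv n.
have k1 := near_projection dE Dn Dw hn.
have k2 := dot_cauchy_schwarz dtE (h - v n) w.
have r1 : rnorm w / (rnorm w + 1) <= 1 by rewrite ler_pdivrMr// mul1r lerDl.
set r := e / 2 / _ in h1 h2 r0.
have rw : r * rnorm w <= e / 2.
  by rewrite /r -mulrA [_^-1 * _]mulrC ler_piMr// divr_ge0// ltW.
have k3 : rnorm (dt (f - v n) w) <= r * rnorm w.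
  rewrite -(@ler_pXn2r _ 2) ?nnegrE ?rnorm_ge0 ?(mulr_ge0 (ltW r0) (rnorm_ge0 w))//.
  rewrite exprMn; apply: le_trans k1 _.
  by rewrite ler_wpM2r ?sqr_ge0// ltW.
have k4 : rnorm (h - v n) * rnorm w <= r * rnorm w.
  by rewrite ler_wpM2r ?rnorm_ge0// ltW.
lra.
Qed.

End Span.

Lemma dense_rnormP (R : realType) (V : completeNormedModType R[i]) (S : set V) :
  dense S -> forall f (eps : R), 0 < eps -> exists2 v, S v & rnorm (f - v) < eps.
Proof.
move=> dS f eps eps0.
have e0 : 0 < eps%:C :> R[i] by rewrite ltcR.
have [] := dS (ball f eps%:C).
- by exists f; exact: ballxx.
- exact: ball_open.
- move=> v []; rewrite -ball_normE/= rnormE ltcR => fv Sv.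
  by exists v.
Qed.

(** * Orthogonal bases *)

Section OrthogonalBasis.
Variables (R : realType) (V : completeNormedModType R[i]).
Variable dt : {dot V for Num.conj}.
Hypothesis dtE : forall u : V, `|u| ^+ 2 = dt u u.
Local Notation C := R[i].
Variables (I : choiceType) (e : I -> V).
Hypotheses (e_neq0 : forall l, e l != 0)
  (e_ortho : forall l m, l != m -> dt (e l) (e m) = 0)
  (e_dense : dense [set f : V | exists (A : {fset I}) (a : I -> C),
                           f = \sum_(l <- A) a l *: e l]).

Definition weight l : R := (rnorm (e l) ^+ 2)^-1.
Local Notation a := weight.

Lemma basis_rnorm_gt0 l : 0 < rnorm (e l).
Proof. by rewrite lt_def rnorm_ge0 rnorm_eq0 e_neq0. Qed.

Lemma weight_gt0 l : 0 < a l.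
Proof. by rewrite invr_gt0 exprn_gt0// basis_rnorm_gt0. Qed.

Lemma weight_ge0 l : 0 <= a l. Proof. exact/ltW/weight_gt0. Qed.

Lemma weightK l : (a l)%:C * dt (e l) (e l) = 1.
Proof.
rewrite (dot_rnorm dtE) -realCM mulVf// expf_neq0// gt_eqF//.
exact: basis_rnorm_gt0.
Qed.

(** The family [b] prescribes moments, not coefficients: a sum of these terms has inner product
    [b l] with [e l]. The adjoint shifts act on moments by translating the index. *)
Definition wterm (b : I -> C) l : V := ((a l)%:C * b l) *: e l.

Lemma dot_wterm b l m : dt (wterm b l) (e m) = if l == m then b m else 0.
Proof.
rewrite /wterm dotZl; case: eqVneq => [<-|/e_ortho ->]; last by rewrite mulr0.
by rewrite mulrAC weightK mul1r.
Qed.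

Lemma dot_sum_wterm (A : {fset I}) b m :
  dt (\sum_(l <- A) wterm b l) (e m) = if m \in A then b m else 0.
Proof.
rewrite dot_suml; case: ifPn => mA.
  rewrite (big_fsetD1 m)//= dot_wterm eqxx big_seq big1 ?addr0// => l.
  by rewrite in_fsetD1 dot_wterm => /andP[/negPf ->].
rewrite big_seq big1// => l lA; rewrite dot_wterm; case: eqVneq => // lm.
by rewrite -lm lA in mA.
Qed.

Lemma dot_sum_wtermr (A : {fset I}) b u :
  dt u (\sum_(l <- A) wterm b l) = \sum_(l <- A) (a l)%:C * (b l)^* * dt u (e l).
Proof.
rewrite dot_sumr; apply: eq_bigr => l _; by rewrite dotZr conjCM conjCR.
Qed.

Lemma rnorm_sum_wterm (A : {fset I}) b :
  rnorm (\sum_(l <- A) wterm b l) ^+ 2 = \sum_(l <- A) a l * rnorm (b l) ^+ 2.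
Proof.
apply: complexI; rewrite -(dot_rnorm dtE) dot_sum_wtermr rmorph_sum/=.
rewrite big_seq [RHS]big_seq; apply: eq_bigr => l lA.
by rewrite dot_sum_wterm lA -mulrA [_^* * _]mulrC mul_conjC_rnorm -realCM.
Qed.

(** [p] is the orthogonal projection of [f] onto the span of [A], so [<f, p> = |p|^2], and
    [|f - p|^2 >= 0] gives the bound. *)
Lemma bessel (A : {fset I}) f :
  \sum_(l <- A) a l * rnorm (dt f (e l)) ^+ 2 <= rnorm f ^+ 2.
Proof.
pose p := \sum_(l <- A) wterm (fun l => dt f (e l)) l.
have fp : dt f p = (rnorm p ^+ 2)%:C.
  rewrite -(dot_rnorm dtE) /p !dot_sum_wtermr big_seq [RHS]big_seq.
  by apply: eq_bigr => l lA; rewrite dot_sum_wterm lA.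
have := rnormBsqr dtE f p; rewrite fp /= -rnorm_sum_wterm -/p.
by have := sqr_ge0 (rnorm (f - p)); lra.
Qed.

Lemma riesz_fischer (b : I -> C) (W : R) :
  (forall A : {fset I}, \sum_(l <- A) a l * rnorm (b l) ^+ 2 <= W) ->
  exists2 f, has_sum predT (wterm b) f & forall l, dt f (e l) = b l.
Proof.
move=> bW.
have [] := @has_sum_sqr_le _ _ _ (wterm b) (fun l => a l * rnorm (b l) ^+ 2) W.
- by move=> l; rewrite mulr_ge0 ?weight_ge0 ?sqr_ge0.
- exact: bW.
- by move=> A; rewrite rnorm_sum_wterm.
move=> f hf; exists f => // l; apply: (dot_cvg dtE (A1 := [fset l]%fset) hf) => A lA.
by rewrite dot_sum_wterm (fsubsetP lA)// inE.
Qed.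

(** Such an [f] is orthogonal to the finite combination [v] approximating it, so [|f| <= |f - v|],
    which is arbitrarily small. *)
Lemma moment_eq0 f : (forall l, dt f (e l) = 0) -> f = 0.
Proof.
move=> f0; apply/eqP; rewrite -rnorm_eq0 eq_le rnorm_ge0 andbT.
apply/ler_addgt0Pr => eps /(dense_rnormP e_dense f)[_ [A [b ->]]].
set v := \sum_(_ <- _) _; rewrite add0r => fv.
have fv0 : dt f v = 0.
  by rewrite dot_sumr big1// => l _; rewrite dotZr f0 mulr0.
rewrite -(@ler_pXn2r _ 2) ?nnegrE ?rnorm_ge0//; last first.
  exact: le_trans (rnorm_ge0 _) (ltW fv).
apply: le_trans (_ : rnorm (f - v) ^+ 2 <= _).
  by rewrite (rnormBsqr dtE) fv0 mulr0 subr0 lerDl sqr_ge0.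
by rewrite ler_pXn2r ?nnegrE ?rnorm_ge0 ?(ltW fv)// (le_trans (rnorm_ge0 _) (ltW fv)).
Qed.

Lemma moment_inj f g : (forall l, dt f (e l) = dt g (e l)) -> f = g.
Proof.
move=> fg; apply/eqP; rewrite -subr_eq0; apply/eqP/moment_eq0 => l.
by rewrite dotBl fg subrr.
Qed.

Lemma expansion f : has_sum predT (wterm (fun l => dt f (e l))) f.
Proof.
have [g hg gE] := riesz_fischer (fun A => bessel A f).
by rewrite (_ : f = g) in hg *; last by apply: moment_inj => l; rewrite gE.
Qed.

(** One inequality is Bessel's. For the other, every partial sum of the expansion has squared norm
    at most the full sum, and this bound passes to the limit [f]. *)
Lemma parseval f :
  (\esum_(l in [set: I]) (a l * rnorm (dt f (e l)) ^+ 2)%:E = (rnorm f ^+ 2)%:E)%E.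
Proof.
apply/eqP; rewrite eq_le (esum_le_fset (fun A => bessel A f))/=.
set S := esum _ _.
have S0 : (0 <= S)%E.
  by apply: esum_ge0 => l _; rewrite lee_fin mulr_ge0 ?weight_ge0 ?sqr_ge0.
have Sfin : S \is a fin_num.
  rewrite ge0_fin_numE//; apply: le_lt_trans (esum_le_fset (fun A => bessel A f)) _.
  exact: ltry.
rewrite -(fineK Sfin) lee_fin.
have -> : fine S = Num.sqrt (fine S) ^+ 2 by rewrite sqr_sqrtr// fine_ge0.
rewrite ler_pXn2r ?nnegrE ?sqrtr_ge0 ?rnorm_ge0//.
apply: (has_sum_rnorm_le (@expansion f)) => A.
rewrite -(@ler_pXn2r _ 2) ?nnegrE ?sqrtr_ge0 ?rnorm_ge0// sqr_sqrtr ?fine_ge0//.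
by rewrite rnorm_sum_wterm -lee_fin (fineK Sfin); exact: fset_le_esum.
Qed.

(** The representing vector must have moments [b l]. Riesz-Fischer produces it, and equality with
    [ell] extends from finite combinations by density. *)
Lemma riesz (ell : V -> C) (B : R) :
  (forall z u v, ell (z *: u + v) = z * ell u + ell v) ->
  (forall u, rnorm (ell u) <= B * rnorm u) ->
  exists g, forall u, ell u = dt u g.
Proof.
move=> ellP ellB.
have ell0 : ell 0 = 0.
  have := ellP 1 0 0; rewrite scale1r addr0 mul1r => /eqP.
  by rewrite -subr_eq subrr eq_sym => /eqP.
have ellZ z u : ell (z *: u) = z * ell u by rewrite -[_ *: _]addr0 ellP ell0 addr0.
have ellD u v : ell (u + v) = ell u + ell v.
  by rewrite -[u]scale1r ellP scale1r mul1r.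
have ell_sum (A : {fset I}) F : ell (\sum_(l <- A) F l) = \sum_(l <- A) ell (F l).
  by elim/big_rec2 : _ => // l y x _ <-; rewrite ellD.
pose b l : C := (ell (e l))^*.
have bB (A : {fset I}) : \sum_(l <- A) a l * rnorm (b l) ^+ 2 <= B ^+ 2.
  rewrite -rnorm_sum_wterm; set v := \sum_(_ <- _) _.
  (* Testing [ell] on [v] itself gives [|v|^2 = ell v <= B |v|], so [|v| <= B] uniformly in [A]. *)
  have lv : ell v = (rnorm v ^+ 2)%:C.
    rewrite rnorm_sum_wterm ell_sum rmorph_sum/=; apply: eq_bigr => l _.
    rewrite ellZ realCM -mul_conjC_rnorm /b -mulrA.
    by rewrite conjC_involutive.
  have := ellB v; rewrite lv rnorm_real ger0_norm ?sqr_ge0// => h.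
  have := rnorm_ge0 v; rewrite le_eqVlt => /predU1P[<-|v0].
    by rewrite expr0n sqr_ge0.
  have vB : rnorm v <= B by rewrite -(ler_pM2r v0) -expr2.
  by rewrite ler_pXn2r ?nnegrE// ?(ltW v0)// (le_trans (ltW v0)).
have [g _ gE] := riesz_fischer bB.
exists g => u.
apply/eqP; rewrite -subr_eq0 -rnorm_eq0 eq_le rnorm_ge0 andbT.
apply/ler_addgt0Pr => eps eps0; rewrite add0r.
have B0 : 0 <= `|B| + rnorm g by rewrite addr_ge0 ?rnorm_ge0.
have d0 : 0 < eps / (`|B| + rnorm g + 1) by rewrite divr_gt0// ltr_wpDl.
have [_ [A [c ->]] uv] := dense_rnormP e_dense u d0.
set v := \sum_(_ <- _) _ in uv.
have vg : ell v = dt v g.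
  rewrite ell_sum dot_suml; apply: eq_bigr => l _.
  by rewrite ellZ dotZl (dotC dt _ g) gE /b conjC_involutive.
have -> : ell u - dt u g = ell (u - v) - dt (u - v) g.
  have -> : ell (u - v) = ell u - ell v.
    by rewrite -(scaleN1r v) addrC ellP mulN1r addrC.
  by rewrite dotBl vg opprB addrA subrK.
apply: le_trans (rnormD _ _) _; rewrite rnormN.
have h1 := ellB (u - v); have h2 := dot_cauchy_schwarz dtE (u - v) g.
have h3 : B * rnorm (u - v) <= `|B| * rnorm (u - v).
  by rewrite ler_wpM2r ?rnorm_ge0// ler_norm.
move: uv; rewrite ltr_pdivlMr ?ltr_wpDl// => /ltW uv.
apply: le_trans uv; apply: le_trans (lerD (le_trans h1 h3) h2) _.
by rewrite [_ * rnorm (u - v)]mulrC -mulrDr ler_wpM2l ?rnorm_ge0// lerDl.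
Qed.

End OrthogonalBasis.

(** * Limits and continuity *)

Section HasSumAlgebra.
Variables (R : realType) (V : normedModType R[i]) (I : choiceType).
Local Notation C := R[i].

Lemma has_sumZ (f : I -> V) s (z : C) :
  has_sum predT f s -> has_sum predT (fun i => z *: f i) (z *: s).
Proof.
move=> /has_sumP fs; apply/has_sumP => eps eps0.
have z0 : 0 < rnorm z + 1 by rewrite ltr_wpDl ?rnorm_ge0.
have [A0 hA0] := fs _ (divr_gt0 eps0 z0).
exists A0 => A /hA0; rewrite -scaler_sumr -scalerBr rnormZ ltr_pdivlMr//.
apply: le_lt_trans; rewrite mulrC ler_wpM2l ?rnorm_ge0//.
by rewrite lerDl.
Qed.

Lemma has_sumD (f g : I -> V) s t : has_sum predT f s -> has_sum predT g t ->
  has_sum predT (fun i => f i + g i) (s + t).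
Proof.
move=> /has_sumP fs /has_sumP gt; apply/has_sumP => eps eps0.
have e0 : 0 < eps / 2 by rewrite divr_gt0.
have [A0 hA0] := fs _ e0; have [B0 hB0] := gt _ e0.
exists (A0 `|` B0)%fset => A; rewrite fsubUset => /andP[/hA0 fA /hB0 gA].
rewrite big_split opprD addrACA; apply: le_lt_trans (rnormD _ _) _.
by rewrite [ltRHS](splitr eps) ltrD.
Qed.

Lemma has_sum_big (J : Type) (r : seq J) (f : J -> I -> V) (s : J -> V) :
  (forall j, has_sum predT (f j) (s j)) ->
  has_sum predT (fun i => \sum_(j <- r) f j i) (\sum_(j <- r) s j).
Proof.
move=> fs; elim: r => [|j r IH].
  apply/has_sumP => eps eps0; exists fset0 => A _.
  rewrite big_nil (eq_bigr (fun=> 0)) ?big1 ?subrr ?rnorm0// => i _.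
  by rewrite big_nil.
rewrite big_cons (_ : (fun i => _) = (fun i => f j i + \sum_(j <- r) f j i)).
  exact: has_sumD.
by apply/funext => i; rewrite big_cons.
Qed.

End HasSumAlgebra.

(** A bridge from convergence of the net to extended real sums: finite sums of a nonnegative family
    increase with the index set, so their limit is their supremum. *)
Lemma has_sum_esum (R : realType) (I : choiceType) (g : I -> R) (s : R[i]) :
  (forall i, 0 <= g i) -> has_sum predT (fun i => (g i)%:C : R[i]^o) s ->
  (\esum_(i in [set: I]) (g i)%:E = (complex.Re s)%:E)%E.
Proof.
move=> g0 /has_sumP gs.
have near (eps : R) : 0 < eps -> exists A0 : {fset I}, forall A,
    (A0 `<=` A)%fset -> `|complex.Re s - \sum_(i <- A) g i| < eps.
  move=> /gs[A0 hA0]; exists A0 => A /hA0.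
  apply: le_lt_trans; rewrite -lecR -rnormE.
  apply: le_trans (normc_ge_Re _) => //.
  by rewrite raddfB/= -rmorph_sum.
apply/eqP; rewrite eq_le; apply/andP; split.
  apply: esum_le_fset => A; apply/ler_addgt0Pr => eps /near[A0 hA0].
  have := hA0 (A0 `|` A)%fset (fsubsetUl _ _); rewrite ltr_norml => /andP[h _].
  have : \sum_(i <- A) g i <= \sum_(i <- (A0 `|` A)%fset) g i.
    rewrite (big_fsetID _ [in A] (A0 `|` A)%fset)/=.
    rewrite (_ : [fset x in _ | x \in A]%fset = A) ?lerDl ?sumr_ge0//.
    by apply/fsetP => i; rewrite !inE/=; case: (i \in A); rewrite ?orbT ?andbF.
  lra.
apply/lee_addgt0Pr => eps /near[A0 /(_ A0 (fsubset_refl _))].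
rewrite ltr_norml => /andP[_ h].
apply: (@le_trans _ _ ((\sum_(i <- A0) g i)%:E + eps%:E)%E).
  by rewrite -EFinD lee_fin; lra.
by rewrite leeD2r// fset_le_esum.
Qed.

Section Continuity.
Variables (R : realType) (V : completeNormedModType R[i]).
Variable dt : {dot V for Num.conj}.
Hypothesis dtE : forall u : V, `|u| ^+ 2 = dt u u.

Lemma rnorm_continuous : continuous (fun f : V => rnorm f : R).
Proof.
move=> f; apply/cvgrPdist_lt => eps eps0.
have e0 : 0 < eps%:C :> R[i] by rewrite ltcR.
near=> g.
have : rnorm (f - g) < eps.
  by rewrite -ltcR -rnormE; near: g; exact: cvgr_dist_lt.
apply: le_lt_trans; rewrite ler_norml; apply/andP; split.
  by have := rnormD (g - f) f; rewrite subrK -(rnormN (g - f)) opprB; lra.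
by have := rnormD (f - g) g; rewrite subrK; lra.
Unshelve. all: by end_near. Qed.

Lemma rnorm_dot_continuous v : continuous (fun f : V => rnorm (dt f v) : R).
Proof.
move=> f; apply/cvgrPdist_lt => eps eps0.
have v0 : 0 < rnorm v + 1 by rewrite ltr_wpDl ?rnorm_ge0.
have e0 : 0 < (eps / (rnorm v + 1))%:C :> R[i] by rewrite ltcR divr_gt0.
near=> g.
have : rnorm (f - g) < eps / (rnorm v + 1).
  by rewrite -ltcR -rnormE; near: g; exact: cvgr_dist_lt.
rewrite ltr_pdivlMr// => h.
have : rnorm (dt f v - dt g v) < eps.
  rewrite -dotBl; apply: le_lt_trans (dot_cauchy_schwarz dtE _ _) _.
  by apply: le_lt_trans h; rewrite ler_wpM2l ?rnorm_ge0 ?lerDl.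
apply: le_lt_trans; rewrite ler_norml; apply/andP; split.
  have := rnormD (dt g v - dt f v) (dt f v); rewrite subrK.
  by rewrite -(rnormN (dt g v - _)) opprB; lra.
by have := rnormD (dt f v - dt g v) (dt g v); rewrite subrK; lra.
Unshelve. all: by end_near. Qed.

Lemma rnorm_sqr_continuous : continuous (fun f : V => rnorm f ^+ 2 : R).
Proof.
by move=> f; apply: (@cvgM R _ _ _ (fun g : V => rnorm g) (fun g => rnorm g));
  exact: rnorm_continuous.
Qed.

Lemma dot_sqr_continuous (w : R) v :
  continuous (fun f : V => w * rnorm (dt f v) ^+ 2 : R).
Proof.
move=> f; apply: (@cvgM R); first exact: cvg_cst.
by apply: (@cvgM R _ _ _ (fun g => rnorm (dt g v)) (fun g => rnorm (dt g v)));
  exact: rnorm_dot_continuous.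
Qed.

Lemma sum_dot_sqr_continuous (J : Type) (r : seq J) (w : J -> R) (v : J -> V) :
  continuous (fun f : V => \sum_(j <- r) w j * rnorm (dt f (v j)) ^+ 2 : R).
Proof.
elim: r => [|j r IH].
  rewrite (_ : (fun f => _) = fun=> 0); first exact: cst_continuous.
  by apply/funext => f; rewrite big_nil.
rewrite (_ : (fun f => _) = fun f => w j * rnorm (dt f (v j)) ^+ 2 +
  \sum_(j <- r) w j * rnorm (dt f (v j)) ^+ 2).
  by move=> f; apply: (@cvgD R R); [exact: dot_sqr_continuous|exact: IH].
by apply/funext => f; rewrite big_cons.
Qed.

Lemma le_of_dense (D : set V) (F G : V -> R) :
  (forall f (eps : R), 0 < eps -> exists2 v, D v & rnorm (f - v) < eps) ->
  continuous F -> continuous G -> (forall v, D v -> F v <= G v) ->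
  forall f, F f <= G f.
Proof.
move=> dD cF cG FG f; rewrite leNgt; apply/negP => GF.
have : \forall g \near f, G g < F g.
  have m1 : (G f + F f) / 2 < F f by lra.
  have m2 : G f < (G f + F f) / 2 by lra.
  near=> g; apply: (@lt_trans _ _ ((G f + F f) / 2)); near: g.
    exact: cvgr_lt (cG f) _ m2.
  exact: cvgr_gt (cF f) _ m1.
move=> /nbhs_ballP[e /= e0].
have eE : e = (complex.Re e)%:C by rewrite RRe_real// gtr0_real.
have /(dD f)[v Dv fv] : 0 < complex.Re e by rewrite -ltcR -eE.
move=> /(_ v); rewrite -ball_normE/= rnormE eE ltcR => /(_ fv).
by rewrite ltNge FG.
Unshelve. all: by end_near. Qed.

End Continuity.

(** * Pairing with infinite sums and Neumann series *)

Section HilbertExtras.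
Variables (R : realType) (V : completeNormedModType R[i]).
Variable dt : {dot V for Num.conj}.
Hypothesis dtE : forall u : V, `|u| ^+ 2 = dt u u.
Local Notation C := R[i].

Lemma has_sum_dot (I : choiceType) (f : I -> V) s v : has_sum predT f s ->
  has_sum predT (fun i => dt (f i) v : C^o) (dt s v).
Proof.
move=> /has_sumP fs; apply/has_sumP => eps eps0.
have v0 : 0 < rnorm v + 1 by rewrite ltr_wpDl ?rnorm_ge0.
have [A0 hA0] := fs _ (divr_gt0 eps0 v0); exists A0 => A /hA0.
rewrite ltr_pdivlMr// => h; rewrite -dot_suml -dotBl.
apply: le_lt_trans (dot_cauchy_schwarz dtE _ _) _; apply: le_lt_trans h.
by rewrite ler_wpM2l ?rnorm_ge0// lerDl.
Qed.

Lemma has_sum_unique (W : normedModType C) (I : choiceType) (f : I -> W) s t :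
  has_sum predT f s -> has_sum predT f t -> s = t.
Proof.
move=> /has_sumP fs /has_sumP ft; apply/eqP; rewrite -subr_eq0 -rnorm_eq0.
rewrite eq_le rnorm_ge0 andbT; apply/ler_addgt0Pr => eps eps0; rewrite add0r.
have e0 : 0 < eps / 2 by rewrite divr_gt0.
have [A hA] := fs _ e0; have [B hB] := ft _ e0.
have := hA _ (fsubsetUl A B); have := hB _ (fsubsetUr A B).
set z := \sum_(_ <- _ | _) _ => h1 h2.
have -> : s - t = (s - z) - (t - z) by rewrite opprB addrA subrK.
by apply: le_trans (rnormD _ _) _; rewrite rnormN; lra.
Qed.

(** [1 - t P] is inverted by iterating [g |-> f + t P g], a contraction of ratio [t]. *)
Lemma neumann (P : V -> V) (t : R) f : 0 <= t -> t < 1 ->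
  (forall z u v, P (z *: u + v) = z *: P u + P v) ->
  (forall u, rnorm (P u) <= rnorm u) -> exists g, g - t%:C *: P g = f.
Proof.
move=> t0 t1 PP Pc.
have PB u v : P (u - v) = P u - P v.
  by rewrite -scaleN1r addrC PP scaleN1r addrC.
have s0 : 0 < 1 - t by rewrite subr_gt0.
pose g := fix g n := if n is n'.+1 then f + t%:C *: P (g n') else 0.
(* [K] is the fixed point of [r |-> |f| + t r], hence a bound on every iterate. *)
pose K := rnorm f / (1 - t).
have K0 : 0 <= K by rewrite divr_ge0 ?rnorm_ge0 ?(ltW s0).
have KE : rnorm f + t * K = K by rewrite /K; field; rewrite gt_eqF.
have gK m : rnorm (g m) <= K.
  elim: m => [|m IH] /=; first by rewrite rnorm0.
  apply: le_trans (rnormD _ _) _; rewrite -[leRHS]KE lerD2l rnormZ rnorm_real ger0_norm//.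
  by rewrite ler_wpM2l// (le_trans (Pc _)).
have gg n m : (n <= m)%N -> rnorm (g n - g m) <= t ^+ n * K.
  elim: n m => [|n IH] m; first by rewrite sub0r rnormN expr0 mul1r.
  case: m => // m nm /=.
  have -> : f + t%:C *: P (g n) - (f + t%:C *: P (g m)) = t%:C *: P (g n - g m).
    by rewrite PB scalerBr opprD addrACA subrr add0r.
  rewrite rnormZ rnorm_real ger0_norm// exprS -mulrA ler_wpM2l//.
  exact: le_trans (Pc _) (IH _ nm).
have small (r : R) : 0 < r -> exists n, forall m, (n <= m)%N -> t ^+ m * K < r.
  move=> r0; have K1 : 0 < K + 1 by rewrite ltr_wpDl.
  have /cvgrPdist_lt/(_ _ (divr_gt0 r0 K1))[n _ hn] : t ^+ m @[m --> \oo] --> (0 : R).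
    by apply: cvg_expr; rewrite ger0_norm.
  exists n => m /hn/=; rewrite sub0r normrN ger0_norm ?exprn_ge0// ltr_pdivlMr//.
  by apply: le_lt_trans; rewrite ler_wpM2l ?exprn_ge0// lerDl.
have c : cauchy (g @ \oo).
  apply/cauchyP => e e0.
  have eE : e = (complex.Re e)%:C by rewrite RRe_real// gtr0_real.
  have e0' : 0 < complex.Re e by rewrite -ltcR -eE.
  have [N hN] := small _ e0'.
  exists (g N); exists N => // n /= Nn.
  rewrite -ball_normE/= rnormE eE ltcR.
  exact: le_lt_trans (gg _ _ Nn) (hN _ (leqnn N)).
have /cvgrPdist_lt gh : g @ \oo --> lim (g @ \oo) by exact: cauchy_cvg.
set h := lim _ in gh; exists h.
apply/eqP; rewrite -subr_eq0 -rnorm_eq0 eq_le rnorm_ge0 andbT.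
apply/ler_addgt0Pr => eps eps0; rewrite add0r.
have e0 : 0 < (eps / 2)%:C :> C by rewrite ltcR divr_gt0.
have [n _ hn] := gh _ e0.
have h1 := hn n (leqnn n); have h2 := hn n.+1 (leqnSn n).
rewrite /= rnormE ltcR in h1; rewrite /= rnormE ltcR in h2.
have -> : h - t%:C *: P h - f = (h - (f + t%:C *: P (g n))) - t%:C *: P (h - g n).
  by rewrite PB scalerBr opprD opprB !addrA subrK addrAC.
apply: le_trans (rnormD _ _) _; rewrite rnormN rnormZ rnorm_real ger0_norm//.
have h3 : t * rnorm (P (h - g n)) <= 1 * rnorm (h - g n).
  by rewrite ler_pM ?rnorm_ge0 ?(ltW t1).
by move: h1 h2 h3; rewrite mul1r; lra.
Qed.

End HilbertExtras.

(** * Admissible spaces and backward shifts *)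

Section Admissible.
Variables (R : realType) (X : Type) (H : rkhs R X).
Local Notation C := R[i].
Local Notation ev := (@rk_eval R X H).
Local Notation k := (@rk_kernel R X H).
Local Notation dt := (rk_dot H).
Local Notation dtE := (@rk_normE R X H).

Definition kernel_at y : H := sval (cid2 (rk_reproducing H y)).

Lemma ev_kernel_at y x : ev (kernel_at y) x = k x y.
Proof. by rewrite /kernel_at; case: cid2 => f /= ->. Qed.

Lemma dot_kernel_at f y : dt f (kernel_at y) = ev f y.
Proof. by rewrite /kernel_at; case: cid2 => g /= _ ->. Qed.

Lemma kernel_sym x y : k x y = (k y x)^*.
Proof. by rewrite -!ev_kernel_at -!dot_kernel_at (dotC dt). Qed.

Lemma ev_inj (f g : H) : (forall x, ev f x = ev g x) -> f = g.
Proof. by move=> fg; apply: rk_eval_inj; exact/funext. Qed.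

Lemma evP (z : C) (f g : H) x : ev (z *: f + g) x = z * ev f x + ev g x.
Proof. by rewrite -!dot_kernel_at dotDl dotZl. Qed.

Lemma evZ (z : C) (f : H) x : ev (z *: f) x = z * ev f x.
Proof. by rewrite -!dot_kernel_at dotZl. Qed.

Lemma evB (f g : H) x : ev (f - g) x = ev f x - ev g x.
Proof. by rewrite -!dot_kernel_at dotBl. Qed.

Definition kernel_span : set H := [set h | exists s : seq (C * X),
  h = \sum_(p <- s) p.1 *: kernel_at p.2].

(** A vector orthogonal to all kernel functions has value zero at every point, and [rk_eval] is
    injective. *)
Lemma kernel_span_dense f (eps : R) : 0 < eps ->
  exists2 v, kernel_span v & rnorm (f - v) < eps.
Proof.
apply: (ortho_eq0_dense dtE).
- by exists [::]; rewrite big_nil.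
- move=> z _ _ [s ->] [t ->]; exists ([seq (z * p.1, p.2) | p <- s] ++ t).
  rewrite big_cat big_map scaler_sumr; congr (_ + _).
  by apply: eq_bigr => p _; rewrite scalerA.
- move=> u uD; apply: ev_inj => x; rewrite -!dot_kernel_at dot0l; apply: uD.
  by exists [:: (1, x)]; rewrite big_seq1 scale1r.
Qed.

Variables (L : countNmodType) (e : L -> H).
Hypothesis He : admissible e.
Local Notation a := (weight e).

Let e_neq0 : forall l, e l != 0. Proof. by case: He => -[]. Qed.
Let e_ortho : forall l m, l != m -> dt (e l) (e m) = 0.
Proof. by case: He => -[]. Qed.
Let e_dense : dense [set f : H | exists (A : {fset L}) (a : L -> C),
                           f = \sum_(l <- A) a l *: e l].
Proof. by case: He => -[]. Qed.

Lemma ev_e0 x : ev (e 0) x = 1. Proof. by case: He. Qed.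
Lemma ev_eM l m x : ev (e l) x * ev (e m) x = ev (e (l + m)) x.
Proof. by case: He. Qed.

(** Through this identification, pairing with [e 0] is evaluation at [x0]. *)
Lemma e0_kernel : exists x0, e 0 = kernel_at x0.
Proof.
case: He => _ _ _ [x0 hx0]; exists x0; apply: ev_inj => x.
by rewrite ev_kernel_at ev_e0 hx0.
Qed.

Lemma dot_e0_e0 : dt (e 0) (e 0) = 1.
Proof. by have [x0 e0E] := e0_kernel; rewrite {2}e0E dot_kernel_at ev_e0. Qed.

Lemma rnorm_e0 : rnorm (e 0) = 1.
Proof.
have := dot_e0_e0; rewrite (dot_rnorm dtE) => -[/eqP].
by rewrite sqrp_eq1 ?rnorm_ge0// => /eqP.
Qed.

Lemma dot_kernel_e0 y : dt (kernel_at y) (e 0) = 1.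
Proof. by rewrite (dotC dt) dot_kernel_at ev_e0 conjC1. Qed.

Lemma dot_kernel_e y l : dt (kernel_at y) (e l) = (ev (e l) y)^*.
Proof. by rewrite (dotC dt) dot_kernel_at. Qed.

(** [coef] chooses some coefficient family; pairing any expansion of [p] with [e l] shows that
    orthogonality forces it. *)
Lemma coefE (phi : X -> C) (p : H) : ev p = phi ->
  coef e phi = fun l => (a l)%:C * dt p (e l).
Proof.
move=> evp; rewrite /coef; set P := [set _ | _].
have Pa : P (fun l => (a l)%:C * dt p (e l)).
  by exists p => //; exact: (@expansion _ _ _ dtE _ e e_neq0 e_ortho e_dense p).
have [f evf hf] := xgetPex (fun=> 0) (ex_intro _ _ Pa).
have fp : f = p by apply: rk_eval_inj; rewrite evf evp.
apply/funext => l; set b := xget _ _ in hf *.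
have -> : dt p (e l) = b l * dt (e l) (e l).
  rewrite -fp; apply: (dot_cvg dtE (A1 := [fset l]%fset) hf) => A.
  rewrite fsub1set => lA; rewrite dot_suml (big_fsetD1 l)//= dotZl big_seq big1.
    by rewrite addr0.
  by move=> m; rewrite in_fsetD1 => /andP[/e_ortho ml _]; rewrite dotZl ml mulr0.
by rewrite mulrCA (weightK dtE e_neq0) mulr1.
Qed.

(** The term of index 0 is [phi x0] and the others sum to [phi x - phi x0]; the triangle inequality
    bounds the sum of their moduli from below. *)
Lemma majorant_ge (p : H) (phi : X -> C) x x0 :
  e 0 = kernel_at x0 -> ev p = phi ->
  ((rnorm (phi x0) + rnorm (phi x - phi x0))%:E <= majorant e phi x)%E.
Proof.
move=> e0E evp; rewrite /majorant (coefE evp).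
pose T l : C := (a l)%:C * dt p (e l) * ev (e l) x.
have T0 : T 0 = phi x0.
  rewrite /T ev_e0 mulr1 e0E dot_kernel_at evp /weight rnorm_e0.
  by rewrite expr1n invr1 mul1r.
have /has_sumP hs : has_sum predT (T : L -> C^o) (phi x).
  have TE : T = fun l => dt (wterm e (fun l => dt p (e l)) l) (kernel_at x).
    by apply/funext => l; rewrite dot_kernel_at evZ.
  have := @expansion _ _ _ dtE _ e e_neq0 e_ortho e_dense p.
  by rewrite TE -evp -dot_kernel_at => /(has_sum_dot dtE); exact.
apply/lee_addgt0Pr => eps /hs[A0 hA0].
pose A := (0 |` A0)%fset; have h := hA0 A (fsubsetUr _ _).
apply: (@le_trans _ _ ((\sum_(l <- A) rnorm (T l))%:E + eps%:E)%E); last first.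
  by rewrite leeD2r// (fset_le_esum (fun l => rnorm (T l))).
have A0' : 0 \in A by rewrite fset1U1.
rewrite -EFinD lee_fin; move: h; rewrite !(big_fsetD1 0 A0')/= T0.
set S := \sum_(_ <- _) _; set S' := \sum_(_ <- _) _ => h.
have SS : rnorm (S : C) <= S'.
  by rewrite /S /S'; elim/big_ind2 : _ => [|u v w z uv wz|//]; rewrite ?rnorm0//;
     apply: le_trans (rnormD _ _) _; exact: lerD.
rewrite -addrA lerD2l; have -> : phi x - phi x0 = S + (phi x - (phi x0 + S)).
  by ring.
apply: le_trans (rnormD _ _) _; rewrite lerD//; exact: ltW.
Qed.

Variables (kappa : X -> X -> C) (c : L -> R).
Hypotheses (c_ge0 : forall l, 0 <= c l)
  (kappaP : forall x y, has_sum predT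
    (fun l => (c l)%:C * ev (e l) x * (ev (e l) y)^* : C^o) (kappa x y))
  (kernelE : forall x y, k x y = 1 + kappa x y * k x y).

Lemma kappa_diag x : (\esum_(l in [set: L]) (c l * rnorm (ev (e l) x) ^+ 2)%:E =
  (complex.Re (kappa x x))%:E)%E.
Proof.
apply: has_sum_esum => [l|]; first by rewrite mulr_ge0 ?sqr_ge0.
rewrite (_ : (fun l => _) =
  fun l => (c l)%:C * ev (e l) x * (ev (e l) x)^*); first exact: kappaP.
by apply/funext => l; rewrite -mulrA mul_conjC_rnorm -realCM.
Qed.

Local Notation sc l := (Num.sqrt (c l)).

Lemma sc_sqr l : sc l ^+ 2 = c l. Proof. exact: sqr_sqrtr. Qed.

Lemma scC l : (c l)%:C = (sc l)%:C * (sc l)%:C :> C.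
Proof. by rewrite -realCM -expr2 sc_sqr. Qed.

(** This is the sum over [l] of the squared norms of the adjoint shifts of [f], each written through
    Parseval because the adjoints are not yet known to exist. *)
Definition shift_energy f : \bar R := (\esum_(l in [set: L]) \esum_(m in [set: L])
  (a m * rnorm ((sc l)%:C * dt f (e (l + m))) ^+ 2)%:E)%E.
Local Notation Q := shift_energy.

(** Kernel functions are eigenvectors of the adjoint shifts, so [T l] is the explicit image of [h].
    Expanded over pairs from [s], the claim reduces term by term to [k = 1 + kappa k]. *)
Lemma kernel_span_norm h : kernel_span h ->
  ((rnorm h ^+ 2)%:E = (rnorm (dt h (e 0)) ^+ 2)%:E + Q h)%E.
Proof.
move=> [s hE].
pose T l := \sum_(p <- s) ((sc l)%:C * p.1 * (ev (e l) p.2)^*) *: kernel_at p.2.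
have TE l m : dt (T l) (e m) = (sc l)%:C * dt h (e (l + m)).
  rewrite hE !dot_suml mulr_sumr; apply: eq_bigr => p _.
  by rewrite !dotZl !dot_kernel_e -ev_eM conjCM; ring.
pose G p q : C := p.1 * q.1^* * k q.2 p.2.
have hh : (rnorm h ^+ 2)%:C = \sum_(p <- s) \sum_(q <- s) G p q.
  rewrite -(dot_rnorm dtE) {1}hE dot_suml; apply: eq_bigr => p _.
  rewrite hE dot_sumr; apply: eq_bigr => q _.
  by rewrite dotZl dotZr dot_kernel_at ev_kernel_at /G; ring.
have h0 : (rnorm (dt h (e 0)) ^+ 2)%:C = \sum_(p <- s) \sum_(q <- s) p.1 * q.1^*.
  have -> : dt h (e 0) = \sum_(p <- s) p.1.
    by rewrite hE dot_suml; apply: eq_bigr => p _; rewrite dotZl dot_kernel_e0 mulr1.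
  rewrite -mul_conjC_rnorm rmorph_sum/= mulr_suml.
  by apply: eq_bigr => p _; rewrite mulr_sumr.
have TT l : (rnorm (T l) ^+ 2)%:C = \sum_(p <- s) \sum_(q <- s)
    G p q * ((c l)%:C * ev (e l) q.2 * (ev (e l) p.2)^*).
  rewrite -(dot_rnorm dtE) dot_suml; apply: eq_bigr => p _.
  rewrite dot_sumr; apply: eq_bigr => q _.
  rewrite dotZl dotZr dot_kernel_at ev_kernel_at /G !conjCM conjCR conjC_involutive.
  by rewrite (scC l); ring.
have sumT : has_sum predT (fun l => (rnorm (T l) ^+ 2)%:C : C^o)
    (\sum_(p <- s) \sum_(q <- s) G p q * kappa q.2 p.2).
  rewrite (_ : (fun l => _) = fun l => \sum_(p <- s) \sum_(q <- s)
    G p q * ((c l)%:C * ev (e l) q.2 * (ev (e l) p.2)^*)); last exact/funext.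
  apply: has_sum_big => p; apply: has_sum_big => q.
  exact: (@has_sumZ _ C^o _ _ _ (G p q) (@kappaP q.2 p.2)).
have QE : Q h = (\esum_(l in [set: L]) (rnorm (T l) ^+ 2)%:E)%E.
  apply: eq_esum => l _; rewrite -(parseval dtE e_neq0 e_ortho e_dense).
  by apply: eq_esum => m _; rewrite TE.
rewrite QE (has_sum_esum _ sumT); last by move=> l; exact: sqr_ge0.
rewrite -EFinD; congr (_%:E).
rewrite -[LHS]/(complex.Re (rnorm h ^+ 2)%:C).
rewrite -[rnorm (dt h _) ^+ 2]/(complex.Re (rnorm (dt h (e 0)) ^+ 2)%:C).
rewrite -raddfD; congr complex.Re.
rewrite hh h0 -big_split; apply: eq_bigr => p _; rewrite -big_split.
by apply: eq_bigr => q _; rewrite /G/= [in LHS]kernelE; ring.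
Qed.

Lemma shift_energy_le f :
  ((rnorm (dt f (e 0)) ^+ 2)%:E + Q f <= (rnorm f ^+ 2)%:E)%E.
Proof.
rewrite /Q esum_esum; last first.
  by move=> l m _ _; rewrite lee_fin mulr_ge0 ?weight_ge0 ?sqr_ge0.
rewrite (_ : _ `*`` _ = [set: L * L]); last by apply/seteqP; split.
pose t f (p : L * L) := a p.2 * rnorm ((sc p.1)%:C * dt f (e (p.1 + p.2))) ^+ 2.
rewrite -leeBrDl// -EFinB; apply: (@esum_le_fset _ _ (t f)) => A.
rewrite lerBrDl; move: f.
(* The extra index [None] carries the term at [e 0], which makes the left-hand side a single finite
   weighted sum of squared moments. *)
have sE f : rnorm (dt f (e 0)) ^+ 2 + \sum_(p <- A) t f p =
    \sum_(j <- None :: [seq Some p | p <- A])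
      (if j is Some p then a p.2 else 1) *
      rnorm (dt f (if j is Some p then (sc p.1)%:C *: e (p.1 + p.2) else e 0)) ^+ 2.
  rewrite big_cons mul1r big_map; congr (_ + _).
  by apply: eq_bigr => p _; rewrite dotZr conjCR.
move=> f; rewrite sE; move: f.
apply: (le_of_dense (kernel_span_dense)).
- exact: (sum_dot_sqr_continuous dtE).
- exact: rnorm_sqr_continuous.
- move=> h Dh; rewrite -sE -lee_fin (kernel_span_norm Dh) EFinD leeD2l//.
  rewrite /Q esum_esum; last first.
    by move=> l m _ _; rewrite lee_fin mulr_ge0 ?weight_ge0 ?sqr_ge0.
  rewrite (_ : _ `*`` _ = [set: L * L]); last by apply/seteqP; split.
  exact: (@fset_le_esum _ _ (t h)).
Qed.

Lemma shift_energy_ge0 f : (0 <= Q f)%E.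
Proof.
apply: esum_ge0 => l _; apply: esum_ge0 => m _.
by rewrite lee_fin mulr_ge0 ?weight_ge0 ?sqr_ge0.
Qed.

Lemma shift_energy_le_norm f : (Q f <= (rnorm f ^+ 2)%:E)%E.
Proof.
by apply: le_trans (shift_energy_le f); rewrite leeDr// lee_fin sqr_ge0.
Qed.

Lemma shift_energy_fin f : Q f \is a fin_num.
Proof.
rewrite ge0_fin_numE ?shift_energy_ge0//.
exact: le_lt_trans (shift_energy_le_norm f) (ltry _).
Qed.

Lemma shift_energy_parallelogram f g :
  (Q (f + g) + Q (f - g) = (Q f + Q f) + (Q g + Q g))%E.
Proof.
have t0 w l m : (0 <= (a m * rnorm ((sc l)%:C * dt w (e (l + m))) ^+ 2)%:E)%E.
  by rewrite lee_fin mulr_ge0 ?weight_ge0 ?sqr_ge0.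
have s0 w l : (0 <= \esum_(m in [set: L])
    (a m * rnorm ((sc l)%:C * dt w (e (l + m))) ^+ 2)%:E)%E by exact: esum_ge0.
rewrite /Q -!esumD//=; do ?by move=> l _; rewrite adde_ge0.
apply: eq_esum => l _; rewrite -!esumD//=; do ?by move=> m _; rewrite adde_ge0.
apply: eq_esum => m _; rewrite -!EFinD; congr (_%:E).
have gen (w x y z t : R) : x + y = 2 * z + 2 * t ->
  w * x + w * y = w * z + w * z + (w * t + w * t) by nra.
apply: gen; rewrite dotDl dotBl mulrDr mulrBr; exact: rnorm_parallelogram.
Qed.

(* The difference [P] of the two sides is nonnegative, satisfies the
   parallelogram law and vanishes on the dense set [kernel_span], so that
   [P f <= 2 * P (f - h) <= 2 * |f - h|^2] for every [h] in that set. *)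
Lemma norm_decomposition f :
  ((rnorm f ^+ 2)%:E = (rnorm (dt f (e 0)) ^+ 2)%:E + Q f)%E.
Proof.
pose P f := rnorm f ^+ 2 - rnorm (dt f (e 0)) ^+ 2 - fine (Q f).
have P0 g : 0 <= P g.
  rewrite /P -addrA -opprD subr_ge0 -lee_fin EFinD fineK ?shift_energy_fin//.
  exact: shift_energy_le.
have PD g h : P (g + h) + P (g - h) = 2 * P g + 2 * P h.
  have := parallelogram dtE g h.
  have := rnorm_parallelogram (dt g (e 0)) (dt h (e 0)).
  rewrite -dotDl -dotBl.
  have := congr1 fine (shift_energy_parallelogram g h).
  rewrite !fineD ?fin_numD ?shift_energy_fin//.
  have gen (a1 a2 a3 a4 b1 b2 b3 b4 c1 c2 c3 c4 : R) :
    a1 + a2 = (a3 + a3) + (a4 + a4) -> b1 + b2 = 2 * b3 + 2 * b4 ->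
    c1 + c2 = 2 * c3 + 2 * c4 ->
    (c1 - b1 - a1) + (c2 - b2 - a2) = 2 * (c3 - b3 - a3) + 2 * (c4 - b4 - a4) by lra.
  exact: gen.
suff : P f = 0.
  move=> /eqP; rewrite /P -addrA -opprD subr_eq0 => /eqP ->.
  by rewrite EFinD fineK ?shift_energy_fin.
apply/eqP; rewrite eq_le P0 andbT; apply/ler_addgt0Pr => eps eps0; rewrite add0r.
have e0 : 0 < Num.sqrt (eps / 2) by rewrite sqrtr_gt0 divr_gt0.
have [h Dh fh] := kernel_span_dense f e0.
have Ph : P h = 0.
  have := kernel_span_norm Dh; rewrite -(fineK (shift_energy_fin h)) -EFinD => -[].
  by rewrite /P => ->; ring.
have := PD h (f - h); rewrite [h + (f - h)]addrC subrK Ph mulr0 add0r.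
have := P0 (h - (f - h)).
have : P (f - h) <= rnorm (f - h) ^+ 2.
  rewrite /P -addrA -opprD gerBl addr_ge0 ?sqr_ge0//.
  by rewrite fine_ge0// shift_energy_ge0.
have : rnorm (f - h) ^+ 2 <= eps / 2.
  rewrite -[leRHS]sqr_sqrtr ?divr_ge0 ?(ltW eps0)//.
  by rewrite ler_pXn2r ?nnegrE ?rnorm_ge0 ?sqrtr_ge0 ?(ltW fh).
lra.
Qed.

(** For fixed [l] the weighted squares of the prescribed moments form one inner sum of the energy,
    which is at most [|f|^2]; Riesz-Fischer applies. *)
Lemma shift_adj_exists l f :
  exists g, forall m, dt g (e m) = (sc l)%:C * dt f (e (l + m)).
Proof.
have [A|g _ gE] := @riesz_fischer _ _ dt dtE _ e e_neq0 e_ortho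
  (fun m => (sc l)%:C * dt f (e (l + m))) (rnorm f ^+ 2); last by exists g.
rewrite -lee_fin; apply: le_trans (fset_le_esum _ _) _.
apply: (le_trans _ (shift_energy_le_norm f)); apply: esum_ge.
by exists [set l]; [split|rewrite fsbig_set1].
Qed.

(* The adjoint of the multiplication by [sqrt (c l) * e l], see [shift_exists]. *)
Definition shift_adj l f : H := sval (cid (shift_adj_exists l f)).
Local Notation Ts := shift_adj.

Lemma dot_shift_adj l f m : dt (Ts l f) (e m) = (sc l)%:C * dt f (e (l + m)).
Proof. by rewrite /Ts; case: cid. Qed.

Lemma norm_shift_adj f : ((rnorm f ^+ 2)%:E = (rnorm (dt f (e 0)) ^+ 2)%:E +
  \esum_(l in [set: L]) (rnorm (Ts l f) ^+ 2)%:E)%E.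
Proof.
rewrite norm_decomposition; congr (_ + _)%E; apply: eq_esum => l _.
rewrite -(parseval dtE e_neq0 e_ortho e_dense).
by apply: eq_esum => m _; rewrite dot_shift_adj.
Qed.

Lemma rnorm_shift_adj l f : rnorm (Ts l f) <= rnorm f.
Proof.
rewrite -(@ler_pXn2r _ 2) ?nnegrE ?rnorm_ge0// -lee_fin (norm_shift_adj f).
apply: le_trans (term_le_esum (fun l => rnorm (Ts l f) ^+ 2) l) _.
by rewrite leeDr// lee_fin sqr_ge0.
Qed.

Lemma shift_adjP l (z : C) f g : Ts l (z *: f + g) = z *: Ts l f + Ts l g.
Proof.
apply: (moment_inj dtE e_dense) => m.
by rewrite dotDl dotZl !dot_shift_adj dotDl dotZl; ring.
Qed.

Lemma shift_adj_kernel l y :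
  Ts l (kernel_at y) = ((sc l)%:C * (ev (e l) y)^*) *: kernel_at y.
Proof.
apply: (moment_inj dtE e_dense) => m.
by rewrite dotZl dot_shift_adj !dot_kernel_e -ev_eM conjCM mulrA.
Qed.

(** The shift itself is recovered from its adjoint by Riesz representation; its values come from
    pairing with kernel functions, which are eigenvectors of the adjoint. *)
Lemma shift_exists l f : exists g, (forall h, dt (Ts l h) f = dt h g) /\
  forall y, ev g y = (sc l)%:C * ev (e l) y * ev f y.
Proof.
have [z u v|u|g gE] := @riesz _ _ dt dtE _ e e_neq0 e_ortho e_dense
  (fun h => dt (Ts l h) f) (rnorm f).
- by rewrite shift_adjP dotDl dotZl.
- apply: le_trans (dot_cauchy_schwarz dtE _ _) _; rewrite mulrC.
  by rewrite ler_wpM2l ?rnorm_ge0// rnorm_shift_adj.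
exists g; split => // y.
rewrite -dot_kernel_at (dotC dt) -gE shift_adj_kernel dotZl !conjCM conjCR.
rewrite conjC_involutive.
by rewrite -(dotC dt) dot_kernel_at.
Qed.

(** In the norm decomposition of [e 0] the constant moment already accounts for the whole norm 1. *)
Lemma shift_adj_e0 l : Ts l (e 0) = 0.
Proof.
have := norm_shift_adj (e 0).
rewrite rnorm_e0 dot_e0_e0 rnorm_real normr1 expr1n => h.
have S0 : (\esum_(l in [set: L]) (rnorm (Ts l (e 0)) ^+ 2)%:E = 0)%E.
  set S := (X in X = _); rewrite -/S in h.
  have := congr1 (fun x => x - 1%:E)%E h; rewrite -EFinB subrr addeAC -EFinB subrr add0e.
  by move=> <-.
have := term_le_esum (fun l => rnorm (Ts l (e 0)) ^+ 2) l; rewrite S0 lee_fin => le0.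
apply/eqP; rewrite -rnorm_eq0 -sqrf_eq0 eq_le le0; exact: sqr_ge0.
Qed.

Lemma e0_ortho_norm (z : C) g : dt g (e 0) = 0 ->
  rnorm (z *: e 0 + g) ^+ 2 = rnorm z ^+ 2 + rnorm g ^+ 2.
Proof.
move=> g0; rewrite (rnormDsqr dtE) rnormZ rnorm_e0 mulr1.
by rewrite dotZl (dotC dt) g0 conjC0 mulr0 mulr0 addr0.
Qed.

(** * The majorant of a multiplier *)

Section MultiplierBound.
Variables (phi : X -> C) (M : H -> H) (B : R).
Hypotheses (B_gt0 : 0 < B)
  (MP : forall f x, ev (M f) x = phi x * ev f x)
  (MB : forall f, rnorm (M f) <= B * rnorm f).

Lemma mul_adj_exists g : exists g', forall f, dt (M f) g = dt f g'.
Proof.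
apply: (@riesz _ _ dt dtE _ e e_neq0 e_ortho e_dense (fun f => dt (M f) g)
  (B * rnorm g)).
  move=> z u v; rewrite -dotZl -dotDl; congr (dt _ _).
  by apply: ev_inj => x; rewrite evP !MP evP; ring.
move=> u; apply: le_trans (dot_cauchy_schwarz dtE _ _) _.
by rewrite mulrAC ler_wpM2r ?rnorm_ge0.
Qed.

Definition mul_adj g : H := sval (cid (mul_adj_exists g)).
Local Notation Ms := mul_adj.

Lemma mul_adjE f g : dt (M f) g = dt f (Ms g).
Proof. by rewrite /Ms; case: cid. Qed.

Lemma mul_adjP (z : C) f g : Ms (z *: f + g) = z *: Ms f + Ms g.
Proof.
apply: (moment_inj dtE e_dense) => m.
rewrite (dotC dt) [RHS](dotC dt); congr (_^*).
by rewrite -mul_adjE !dotDr !dotZr -!mul_adjE.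
Qed.

Lemma rnorm_mul_adj g : rnorm (Ms g) <= B * rnorm g.
Proof.
have [->|s0] := eqVneq (Ms g) 0.
  by rewrite rnorm0 mulr_ge0 ?rnorm_ge0 ?(ltW B_gt0).
have s1 : 0 < rnorm (Ms g) by rewrite lt_def rnorm_ge0 rnorm_eq0 s0.
have := dot_cauchy_schwarz dtE (M (Ms g)) g.
rewrite mul_adjE (dot_rnorm dtE) rnorm_real ger0_norm ?sqr_ge0// => h.
have := le_trans h (ler_wpM2r (rnorm_ge0 g) (MB (Ms g))).
by rewrite mulrAC expr2 ler_pM2r.
Qed.

(** Both operators are adjoints of multiplications by functions, and multiplications commute. *)
Lemma mul_adj_shift_adj l f : Ms (Ts l f) = Ts l (Ms f).
Proof.
apply: (moment_inj dtE e_dense) => m; set g := e m.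
have [g1 [g1E g1P]] := shift_exists l g.
have [g2 [g2E g2P]] := shift_exists l (M g).
rewrite g1E (dotC dt) -mul_adjE -(dotC dt) g2E.
rewrite (dotC dt (Ms f)) -mul_adjE -(dotC dt); congr (dt _ _).
by apply: ev_inj => x; rewrite g2P !MP g1P; ring.
Qed.

Let p := M (e 0).
Let phi0 := dt p (e 0).
Let q f := B ^+ 2 * rnorm f ^+ 2 - rnorm (Ms f) ^+ 2.

Lemma defect_ge0 f : 0 <= q f.
Proof.
rewrite subr_ge0 -exprMn ler_pXn2r ?nnegrE ?rnorm_ge0 ?rnorm_mul_adj//.
by rewrite mulr_ge0 ?rnorm_ge0 ?(ltW B_gt0).
Qed.

(** [e 0] is the kernel function at [x0], and kernel functions are eigenvectors of the adjoint of a
    multiplier. *)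
Lemma mul_adj_e0 : Ms (e 0) = phi0^* *: e 0.
Proof.
have [x0 e0E] := e0_kernel.
have key f : dt (M f) (e 0) = phi0 * dt f (e 0).
  rewrite /phi0 /p e0E !dot_kernel_at !MP -e0E ev_e0; ring.
apply: (moment_inj dtE e_dense) => m; rewrite (dotC dt) -mul_adjE key conjCM dotZl.
by rewrite -(dotC dt).
Qed.

Let s2 := B ^+ 2 - rnorm phi0 ^+ 2.

Lemma defect_e0 : q (e 0) = s2.
Proof.
by rewrite /q mul_adj_e0 rnormZ rnorm_e0 rnormJ expr1n !mulr1.
Qed.

Lemma defect_e0_ge0 : 0 <= s2. Proof. by rewrite -defect_e0 defect_ge0. Qed.

Lemma defect_add (z : C) g : dt g (e 0) = 0 ->
  q (z *: e 0 + g) = rnorm z ^+ 2 * s2 + q g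
    - 2 * complex.Re (z * (phi0^* * dt p g)).
Proof.
move=> g0; rewrite /q (e0_ortho_norm _ g0) mul_adjP mul_adj_e0 scalerA.
rewrite (rnormDsqr dtE) dotZl -mul_adjE -/p -mulrA.
by rewrite rnormZ rnorm_e0 mulr1 rnormM rnormJ /s2 exprMn; ring.
Qed.

(** For [s > 0] the value [t = 1 / s] is optimal. For [s = 0] the expression is affine in [t], and
    [t = (D + 1) / A] would make it negative if [A > 0]. *)
Lemma quad_nonneg (A s D : R) : 0 <= A -> 0 <= s -> 0 <= D ->
  (forall t, 0 <= t ^+ 2 * A * s + D - 2 * (t * A)) -> A <= s * D.
Proof.
move=> A0 s0 D0 h; have [s1|s1] := ltP 0 s.
  have := h s^-1.
  have -> : s^-1 ^+ 2 * A * s + D - 2 * (s^-1 * A) = D - A / s.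
    by field; rewrite gt_eqF.
  by rewrite subr_ge0 ler_pdivrMr// mulrC.
have sE : s = 0 by apply/eqP; rewrite eq_le s1.
rewrite sE mul0r leNgt; apply/negP => A1.
have := h ((D + 1) / A); rewrite sE mulr0 add0r divfK ?gt_eqF//; lra.
Qed.

(** Cauchy-Schwarz for the nonnegative form [q] between [e 0] and [g]. The coefficient of [e 0] is a
    real multiple of the conjugate of [w], which makes the cross term real. *)
Lemma defect_cauchy_schwarz g : dt g (e 0) = 0 ->
  rnorm (phi0^* * dt p g) ^+ 2 <= s2 * q g.
Proof.
move=> g0; set w := phi0^* * _.
apply: quad_nonneg; rewrite ?sqr_ge0 ?defect_e0_ge0 ?defect_ge0// => t.
have := defect_ge0 ((t%:C * w^*) *: e 0 + g); rewrite (defect_add _ g0) -/w.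
rewrite rnormM rnormJ rnorm_real exprMn real_normK ?num_real//.
rewrite -mulrA [w^* * w]mulrC mul_conjC_rnorm -realCM.
by [].
Qed.

(** Triangle inequality for the seminorm [sqrt q], whose value at [e 0] is [sqrt s2]. *)
Lemma sqrt_defect_add (z : C) g : dt g (e 0) = 0 ->
  Num.sqrt (q (z *: e 0 + g)) <= rnorm z * Num.sqrt s2 + Num.sqrt (q g).
Proof.
move=> g0; set w := phi0^* * dt p g.
rewrite -(@ler_pXn2r _ 2) ?nnegrE ?addr_ge0 ?mulr_ge0 ?sqrtr_ge0 ?rnorm_ge0//.
rewrite sqr_sqrtr ?defect_ge0// (defect_add _ g0) -/w.
have h1 : rnorm w <= Num.sqrt s2 * Num.sqrt (q g).
  rewrite -(@ler_pXn2r _ 2) ?nnegrE ?mulr_ge0 ?sqrtr_ge0 ?rnorm_ge0//.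
  rewrite exprMn !sqr_sqrtr ?defect_ge0 ?defect_e0_ge0//; exact: defect_cauchy_schwarz.
have h2 : - complex.Re (z * w) <= rnorm z * (Num.sqrt s2 * Num.sqrt (q g)).
  rewrite -raddfN; apply: le_trans (le_Re_rnorm _) _.
  by rewrite rnormN rnormM ler_wpM2l ?rnorm_ge0.
have := sqr_sqrtr defect_e0_ge0; have := sqr_sqrtr (defect_ge0 g).
by rewrite sqrrD exprMn => -> ->; rewrite -mulrA; lra.
Qed.

(** The norm decompositions of [B g] and of [Ms g] are subtracted. The former has no constant
    moment, the latter has one of modulus [|<p, g>|], and [Ms] commutes with every [Ts l]. *)
Lemma defect_shift g : dt g (e 0) = 0 ->
  ((q g + rnorm (dt p g) ^+ 2)%:E = \esum_(l in [set: L]) (q (Ts l g))%:E)%E.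
Proof.
move=> g0.
have h1 := norm_shift_adj (B%:C *: g).
have h2 := norm_shift_adj (Ms g).
have BE f : rnorm (B%:C *: f) ^+ 2 = B ^+ 2 * rnorm f ^+ 2.
  by rewrite rnormZ exprMn rnorm_real real_normK ?num_real.
move: h1; rewrite BE dotZl g0 mulr0 rnorm0 expr0n add0e => h1.
have e1 : (\esum_(l in [set: L]) (rnorm (Ts l (B%:C *: g)) ^+ 2)%:E =
    \esum_(l in [set: L]) (q (Ts l g))%:E +
    \esum_(l in [set: L]) (rnorm (Ts l (Ms g)) ^+ 2)%:E)%E.
  rewrite -esumD; [|by move=> l _; rewrite lee_fin defect_ge0|
    by move=> l _; rewrite lee_fin sqr_ge0].
  apply: eq_esum => l _; rewrite -EFinD; congr (_%:E).
  have -> : Ts l (B%:C *: g) = B%:C *: Ts l g.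
    rewrite -[_ *: g]addr0 shift_adjP.
    suff -> : Ts l 0 = 0 by rewrite addr0.
    by apply/eqP; rewrite -rnorm_eq0 eq_le rnorm_ge0 andbT;
       have := rnorm_shift_adj l 0; rewrite rnorm0.
  by rewrite BE -mul_adj_shift_adj /q subrK.
move: h2; rewrite (dotC dt) -mul_adjE -/p rnormJ => h2.
(* Cancelling [S2] is legitimate because a real value of [Sq + S2] excludes infinite summands. *)
have gen (u v d : R) (S Sq S2 : \bar R) : u%:E = S -> S = (Sq + S2)%E ->
    v%:E = (d%:E + S2)%E -> (u - v + d)%:E = Sq.
  case: S2 => [s| |]; case: Sq => [t| |] //= <- // [->] [->]; congr (_%:E); ring.
exact: gen h1 e1 h2.
Qed.

Variable x : X.
Let u l := rnorm (ev (e l) x).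
Let K := B * rnorm (kernel_at x).

Local Notation off f := (f - dt f (e 0) *: e 0).

Lemma rnorm_ev_e0 : u 0 = 1.
Proof. by rewrite /u ev_e0 -(rmorph1 (real_complex R)) rnorm_real normr1. Qed.

(** Parseval compares [f] with [t] times the kernel function at [x], whose moments have modulus
    [t u m]. *)
Lemma dominated_norm (t : R) f : 0 <= t ->
  (forall m, rnorm (dt f (e m)) <= t * u m) -> rnorm f <= t * rnorm (kernel_at x).
Proof.
move=> t0 fu; have -> : t * rnorm (kernel_at x) = rnorm (t%:C *: kernel_at x).
  by rewrite rnormZ rnorm_real ger0_norm.
rewrite -(@ler_pXn2r _ 2) ?nnegrE ?rnorm_ge0// -lee_fin.
rewrite -!(parseval dtE e_neq0 e_ortho e_dense); apply: le_esum => m _.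
rewrite lee_fin ler_wpM2l ?weight_ge0// ler_pXn2r ?nnegrE ?rnorm_ge0//.
by rewrite dotZl dot_kernel_e rnormM rnormJ rnorm_real ger0_norm.
Qed.

Hypothesis kappa_le : complex.Re (kappa x x) <= 9%:R^-1.

(** The bound 1/9 on [kappa x x] enters here and becomes the ratio 1/3 of the iteration. *)
Lemma weighted_sum_le (s : R) (A : {fset L}) : 0 <= s ->
  \sum_(l <- A) (s * sc l * u l) ^+ 2 <= (s / 3%:R) ^+ 2.
Proof.
move=> s0; have -> : \sum_(l <- A) (s * sc l * u l) ^+ 2 =
    s ^+ 2 * \sum_(l <- A) c l * u l ^+ 2.
  by rewrite mulr_sumr; apply: eq_bigr => l _; rewrite !exprMn sc_sqr mulrA.
rewrite exprMn ler_wpM2l ?sqr_ge0// exprVn -natrX; apply: le_trans kappa_le.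
by rewrite -lee_fin -kappa_diag; exact: fset_le_esum.
Qed.

(** By multiplicativity of the basis, [Ts l f] is dominated with constant [t * sc l * u l]. The
    assumed bound [D] applies to each of these, and their squares are summed. *)
Lemma dominated_defect_step (t D : R) f : 0 <= t -> 0 <= D ->
  (forall (s : R) h, 0 <= s -> (forall m, rnorm (dt h (e m)) <= s * u m) ->
    Num.sqrt (q h) <= s * D) ->
  (forall m, rnorm (dt f (e m)) <= t * u m) ->
  q (off f) + rnorm (dt p (off f)) ^+ 2 <= (t * D / 3%:R) ^+ 2.
Proof.
move=> t0 D0 hD fu; set g := off f.
have g0 : dt g (e 0) = 0 by rewrite dotBl dotZl dot_e0_e0 mulr1 subrr.
(* The adjoint shifts annihilate constants, so removing the constant part of [f] does not affect
   them. *)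
have TgE l : Ts l g = Ts l f.
  rewrite /g -scaleNr addrC shift_adjP shift_adj_e0 scaler0 add0r//.
rewrite -lee_fin (defect_shift g0); apply: esum_le_fset => A.
apply: le_trans (weighted_sum_le A (mulr_ge0 t0 D0)); apply: ler_sum => l _.
rewrite TgE -[leLHS]sqr_sqrtr ?defect_ge0//.
have s0 : 0 <= t * sc l * u l by rewrite !mulr_ge0 ?sqrtr_ge0 ?rnorm_ge0.
rewrite ler_pXn2r ?nnegrE ?sqrtr_ge0//; last first.
  by rewrite !mulr_ge0 ?sqrtr_ge0 ?rnorm_ge0.
have -> : t * D * sc l * u l = t * sc l * u l * D by ring.
apply: hD => // m.
rewrite dot_shift_adj rnormM rnorm_real ger0_norm ?sqrtr_ge0//.
have := fu (l + m); rewrite /u -ev_eM rnormM => h.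
rewrite -!mulrA; have := ler_wpM2l (sqrtr_ge0 (c l)) h; congr (_ <= _); ring.
Qed.

(* [3 / 2 * s] is the fixed point of the iteration [D |-> s + D / 3]. *)
Lemma sqrt_defect_le n (t : R) f : 0 <= t ->
  (forall m, rnorm (dt f (e m)) <= t * u m) ->
  Num.sqrt (q f) <= t * (3%:R / 2 * Num.sqrt s2 + K / 3%:R ^+ n).
Proof.
have K0 : 0 <= K by rewrite mulr_ge0 ?rnorm_ge0 ?(ltW B_gt0).
elim: n t f => [|n IH] t f t0 fu.
  (* The iteration starts from the crude bound [sqrt (q f) <= B |f| <= t K]. *)
  rewrite expr0 divr1; apply: (@le_trans _ _ (t * K)); last first.
    by rewrite ler_wpM2l// lerDr mulr_ge0 ?sqrtr_ge0 ?divr_ge0.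
  rewrite -(@ler_pXn2r _ 2) ?nnegrE ?sqrtr_ge0 ?(mulr_ge0 t0 K0)// sqr_sqrtr ?defect_ge0//.
  apply: (@le_trans _ _ ((B * rnorm f) ^+ 2)).
    by rewrite /q exprMn gerBl sqr_ge0.
  rewrite ler_pXn2r ?nnegrE ?mulr_ge0 ?rnorm_ge0 ?(ltW B_gt0)//.
  rewrite /K mulrCA ler_wpM2l ?(ltW B_gt0)//; exact: dominated_norm.
set D := 3%:R / 2 * Num.sqrt s2 + K / 3%:R ^+ n in IH.
have D0 : 0 <= D.
  apply: addr_ge0; first by rewrite mulr_ge0 ?sqrtr_ge0 ?divr_ge0.
  exact: divr_ge0 K0 (exprn_ge0 _ _).
pose g := off f.
have g0 : dt g (e 0) = 0 by rewrite dotBl dotZl dot_e0_e0 mulr1 subrr.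
have qg := dominated_defect_step t0 D0 (fun s h s0 => IH s h s0) fu; rewrite /= -/g in qg.
have {}qg : Num.sqrt (q g) <= t * D / 3%:R.
  rewrite -(@ler_pXn2r _ 2) ?nnegrE ?sqrtr_ge0 ?mulr_ge0// sqr_sqrtr ?defect_ge0//.
  by apply: le_trans qg; rewrite lerDl sqr_ge0.
have := sqrt_defect_add (dt f (e 0)) g0.
rewrite /g addrC subrK -/g; move=> /le_trans; apply.
have f0 : rnorm (dt f (e 0)) * Num.sqrt s2 <= t * Num.sqrt s2.
  by rewrite ler_wpM2r ?sqrtr_ge0//; have := fu 0; rewrite rnorm_ev_e0 mulr1.
apply: le_trans (lerD f0 qg) _; rewrite le_eqVlt; apply/orP; left; apply/eqP.
by rewrite /D exprS; field; rewrite expf_neq0// pnatr_eq0.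
Qed.

(** Limit in [n], with an explicit [n] such that [3 ^ n >= w / eps]. *)
Lemma le_geometric (y z w : R) : (forall n, y <= z + w / 3%:R ^+ n) -> y <= z.
Proof.
move=> h; apply/ler_addgt0Pr => eps eps0.
have [w0|w0] := leP w 0.
  have := h 0%N; rewrite expr0 divr1; lra.
apply: le_trans (h (Num.truncn (w / eps))) _; rewrite lerD2l.
rewrite ler_pdivrMr ?exprn_gt0// mulrC -ler_pdivrMr//.
apply: le_trans (ltW (truncnS_gt _)) _; rewrite -natrX ler_nat.
exact: ltn_expl.
Qed.

Lemma dominated_off_constant f : (forall m, rnorm (dt f (e m)) <= u m) ->
  B * rnorm (dt p (off f)) <= s2 / 2.
Proof.
move=> fu; set g := off f.
have g0 : dt g (e 0) = 0 by rewrite dotBl dotZl dot_e0_e0 mulr1 subrr.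
have K0 : 0 <= K by rewrite mulr_ge0 ?rnorm_ge0 ?(ltW B_gt0).
have fu1 m : rnorm (dt f (e m)) <= 1 * u m by rewrite mul1r.
pose E := q g + rnorm (dt p g) ^+ 2.
have E0 : 0 <= E by rewrite addr_ge0 ?defect_ge0 ?sqr_ge0.
have : Num.sqrt E <= Num.sqrt s2 / 2.
  (* One more step divides the bound [D] by 3, and the limit 3/2 of the coefficient of [sqrt s2]
     becomes 1/2. *)
  apply: (@le_geometric _ _ (K / 3%:R)) => n.
  pose D := 3%:R / 2 * Num.sqrt s2 + K / 3%:R ^+ n.
  have D0 : 0 <= D.
  apply: addr_ge0; first by rewrite mulr_ge0 ?sqrtr_ge0 ?divr_ge0.
  exact: divr_ge0 K0 (exprn_ge0 _ _).
  have := dominated_defect_step ler01 D0 (fun s h s0 => @sqrt_defect_le n s h s0) fu1.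
  rewrite /= -/g -/E mul1r => h.
  have -> : Num.sqrt s2 / 2 + K / 3%:R / 3%:R ^+ n = D / 3%:R.
    by rewrite /D; field; rewrite expf_neq0// pnatr_eq0.
  by rewrite -(@ler_pXn2r _ 2) ?nnegrE ?sqrtr_ge0 ?mulr_ge0// sqr_sqrtr.
move=> hE.
rewrite -(@ler_pXn2r _ 2) ?nnegrE ?mulr_ge0 ?rnorm_ge0 ?(ltW B_gt0) ?invr_ge0 ?defect_e0_ge0//.
have := defect_cauchy_schwarz g0; rewrite rnormM rnormJ !exprMn => h.
have hE2 : E <= s2 / 4%:R.
  have := hE; rewrite -(@ler_pXn2r _ 2) ?nnegrE ?mulr_ge0 ?sqrtr_ge0//.
  rewrite exprMn !sqr_sqrtr ?defect_e0_ge0//; lra.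
have BE : B ^+ 2 = s2 + rnorm phi0 ^+ 2 by rewrite /s2 subrK.
(* Adding [s2 |<p, g>|^2] to the Cauchy-Schwarz bound [|phi0|^2 |<p, g>|^2 <= s2 q g] gives
   [B^2 |<p, g>|^2 <= s2 E <= s2^2 / 4]. *)
rewrite BE mulrDl; apply: (@le_trans _ _ (s2 * E)).
  by rewrite /E mulrDr [leLHS]addrC lerD2r.
apply: le_trans (ler_wpM2l defect_e0_ge0 hE2) _; rewrite expr2; lra.
Qed.

End MultiplierBound.

Lemma majorant_le (phi : X -> C) (M : H -> H) (B : R) (x : X) : 0 < B ->
  (forall f x, ev (M f) x = phi x * ev f x) ->
  (forall f, rnorm (M f) <= B * rnorm f) ->
  complex.Re (kappa x x) <= 9%:R^-1 -> (majorant e phi x <= B%:E)%E.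
Proof.
move=> B0 MP MB kx; set p := M (e 0).
have evp : ev p = phi by apply/funext => y; rewrite MP ev_e0 mulr1.
pose d l := dt p (e l); pose u l := rnorm (ev (e l) x).
rewrite /majorant (coefE evp).
(* [s l] has modulus [u l] and the phase of [d l]. Where [d l = 0] the term of the majorant
   vanishes, and 0 is a harmless choice. *)
pose s l : C := if d l == 0 then 0 else (u l / rnorm (d l))%:C * d l.
have su l : rnorm (s l) <= u l.
  rewrite /s; case: eqVneq => [_|d0]; first by rewrite rnorm0 rnorm_ge0.
  rewrite rnormM rnorm_real ger0_norm ?divr_ge0 ?rnorm_ge0//.
  by rewrite divfK// rnorm_eq0.
have sd l : (s l)^* * d l = (u l * rnorm (d l))%:C.
  rewrite /s; case: eqVneq => [->|d0]; first by rewrite rnorm0 !mulr0.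
  rewrite conjCM conjCR -mulrA [_^* * _]mulrC mul_conjC_rnorm -realCM; congr (_%:C).
  by rewrite expr2 mulrA divfK// rnorm_eq0.
(* Index 0 is adjoined to the finite set so that the constant moment of [f] is exactly [s 0]; the
   sum can only grow. *)
apply: esum_le_fset => A0; set A := (0 |` A0)%fset.
have t0 l : 0 <= rnorm ((a l)%:C * dt p (e l) * ev (e l) x) by exact: rnorm_ge0.
have tE l : rnorm ((a l)%:C * dt p (e l) * ev (e l) x) = a l * (u l * rnorm (d l)).
  by rewrite !rnormM rnorm_real ger0_norm ?weight_ge0// -mulrA [_ * rnorm (ev _ _)]mulrC.
apply: (@le_trans _ _ (\sum_(l <- A) a l * (u l * rnorm (d l)))).
  under [leRHS]eq_bigr do rewrite -tE.
  have [A00|A00] := boolP (0 \in A0).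
    rewrite le_eqVlt (_ : A = A0) ?eqxx//.
    by apply/fsetP => i; rewrite !inE; case: eqVneq => // ->; rewrite A00.
  by rewrite big_fsetU1//= lerDr t0.
pose f := \sum_(l <- A) wterm e s l.
set S := \sum_(_ <- _) _.
have pf : dt p f = S%:C.
  rewrite (dot_sum_wtermr _ e) rmorph_sum/=; apply: eq_bigr => l _.
  by rewrite -mulrA sd -realCM.
have fu m : rnorm (dt f (e m)) <= u m.
  rewrite (dot_sum_wterm dtE e_neq0 e_ortho); case: ifP => // _.
  by rewrite rnorm0 rnorm_ge0.
have f0 : dt f (e 0) = s 0.
  by rewrite (dot_sum_wterm dtE e_neq0 e_ortho) fset1U1.
have := dominated_off_constant B0 MP MB kx fu.
rewrite -/p dotBr dotZr pf f0 -/(d 0) sd.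
have -> : u 0 = 1 by exact: rnorm_ev_e0.
rewrite mul1r => h.
have {h} : B * (S - rnorm (d 0)) <= (B ^+ 2 - rnorm (d 0) ^+ 2) / 2.
  apply: le_trans h; rewrite ler_wpM2l ?(ltW B0)//.
  have := le_Re_rnorm (S%:C - (rnorm (d 0))%:C : C).
  by rewrite raddfB.
(* [(B - |d 0|)^2 >= 0] turns [S <= |d 0| + (B^2 - |d 0|^2) / (2 B)] into [S <= B]. *)
have := sqr_ge0 (B - rnorm (d 0)); rewrite sqrrB => h1 h2.
by rewrite -(ler_pM2l B0) -expr2; lra.
Qed.

(** * The kernel on the diagonal and the points satisfying the Bohr inequality *)

Lemma kernel_diag x : k x x = (rnorm (kernel_at x) ^+ 2)%:C.
Proof. by rewrite -(dot_rnorm dtE) dot_kernel_at ev_kernel_at. Qed.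

Lemma kernel_norm_ge1 x : 1 <= rnorm (kernel_at x) ^+ 2.
Proof.
rewrite -lee_fin norm_shift_adj dot_kernel_e0.
rewrite -(rmorph1 (real_complex R)) rnorm_real normr1 expr1n leeDl//.
by apply: esum_ge0 => l _; rewrite lee_fin sqr_ge0.
Qed.

Lemma kappaE x : kappa x x = (1 - (rnorm (kernel_at x) ^+ 2)^-1)%:C.
Proof.
have n0 : rnorm (kernel_at x) ^+ 2 != 0.
  by rewrite gt_eqF// (lt_le_trans ltr01 (kernel_norm_ge1 x)).
have n0C : (rnorm (kernel_at x) ^+ 2)%:C != 0 :> C.
  by rewrite (inj_eq (@complexI R) _ 0).
have := kernelE x x; rewrite kernel_diag => h.
apply: (mulIf n0C); rewrite -realCM mulrBl mul1r mulVf//.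
rewrite rmorphB /= rmorph1; apply/eqP; rewrite eq_sym subr_eq addrC; exact/eqP.
Qed.

(** On the diagonal [kappa = 1 - 1 / k], and for [n > 0] the condition [1 - 1 / n <= 1 / 9] means
    [n <= 9 / 8]. *)
Lemma kernel_le_kappa_le x :
  (k x x <= 9%:R / 8%:R) = (complex.Re (kappa x x) <= 9%:R^-1).
Proof.
have n1 := kernel_norm_ge1 x; rewrite kernel_diag kappaE.
set n := rnorm _ ^+ 2 in n1 *; have n0 : 0 < n by lra.
have -> : 9%:R / 8%:R = (9%:R / 8%:R : R)%:C :> C.
  by rewrite rmorphM/= fmorphV !rmorph_nat.
rewrite lecR -[complex.Re _]/(1 - n^-1); apply/idP/idP => h.
  have : 8%:R / 9%:R <= n^-1 by rewrite -[leLHS]invrK lef_pV2 ?posrE ?invf_div ?divr_gt0.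
  lra.
rewrite -[leRHS]invrK -[leLHS]invrK lef_pV2 ?posrE ?invr_gt0 ?divr_gt0// invf_div; lra.
Qed.

Lemma le_kernel_bohr x : k x x <= 9%:R / 8%:R -> bohr_set e x.
Proof.
rewrite kernel_le_kappa_le => kx phi [phiM [B hB]].
have M0 : mulop phi (0 : H) = 0.
  apply: ev_inj => y; rewrite phiM; have := evZ 0 0 y.
  by rewrite scale0r mul0r => ->; rewrite mulr0.
have MZ (z : C) f : mulop phi (z *: f) = z *: mulop phi f :> H.
  by apply: ev_inj => y; rewrite evZ !phiM evZ mulrCA.
have NM f : rnorm (mulop phi f : H) <= multiplier_norm H phi * rnorm f.
  have [->|f0] := eqVneq f 0; first by rewrite M0 !rnorm0 mulr0.
  have nf : 0 < rnorm f by rewrite lt_def rnorm_ge0 rnorm_eq0 f0.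
  rewrite -ler_pdivrMr// mulrC.
  have -> : (rnorm f)^-1 * rnorm (mulop phi f : H) =
      rnorm (mulop phi (((rnorm f)^-1)%:C *: f) : H).
    by rewrite MZ rnormZ rnorm_real ger0_norm ?invr_ge0 ?rnorm_ge0.
  apply: ub_le_sup.
    exists `|B| => _ [g /= g1 <-]; apply: le_trans (hB g) _.
    apply: le_trans (ler_wpM2r (rnorm_ge0 g) (ler_norm B)) _.
    by rewrite ler_piMr.
  exists (((rnorm f)^-1)%:C *: f) => //=.
  by rewrite rnormZ rnorm_real ger0_norm ?invr_ge0 ?rnorm_ge0// mulVf ?gt_eqF.
have N0 : 0 <= multiplier_norm H phi.
  have := NM (e 0); rewrite rnorm_e0 mulr1; apply: le_trans.
  exact: rnorm_ge0.
(* [majorant_le] asks for a positive bound, whereas the multiplier norm may be zero; hence the added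
   [eps]. *)
apply/lee_addgt0Pr => eps eps0; rewrite -EFinD.
apply: (@majorant_le phi (mulop phi)) => //.
- by rewrite ltr_wpDl.
- by move=> f y; rewrite phiM.
- by move=> f; apply: le_trans (NM f) _; rewrite ler_wpM2r ?rnorm_ge0// lerDl ltW.
Qed.

(** * Extremal multipliers *)

Section Converse.
Variables (x : X) (rho : R).
Hypotheses (rho_gt0 : 0 < rho) (rhoE : rho ^+ 2 = complex.Re (kappa x x)).
Let psi y := kappa y x / rho%:C.

(** Multiplication by [psi] combines the shifts with coefficients [b l]: a column of norm at most
    one followed by a row contraction. For a partial sum [S], [|S|^2] is rewritten with the vectors
    [Ts l S], whose total squared norm is at most [|S|^2]. *)
Lemma psi_contraction f : exists g,
  (forall y, ev g y = psi y * ev f y) /\ rnorm g <= rnorm f.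
Proof.
have rhoC : rho%:C != 0 :> C by rewrite (inj_eq (@complexI R) _ 0) gt_eqF.
have /choice[tf tfP] l := shift_exists l f.
pose b l : C := (sc l)%:C * (ev (e l) x)^* / rho%:C.
pose w l := rnorm (b l) ^+ 2 * rnorm f ^+ 2.
have bE l : rnorm (b l) ^+ 2 = c l * rnorm (ev (e l) x) ^+ 2 / rho ^+ 2.
  rewrite /b -fmorphV !rnormM rnormJ !rnorm_real.
  rewrite !ger0_norm ?sqrtr_ge0 ?invr_ge0 ?(ltW rho_gt0)//.
  by rewrite !exprMn sc_sqr// exprVn.
have w0 l : 0 <= w l by rewrite mulr_ge0 ?sqr_ge0.
have wW (A : {fset L}) : \sum_(l <- A) w l <= rnorm f ^+ 2.
  rewrite -mulr_suml ler_piMl ?sqr_ge0//.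
  under eq_bigr do rewrite bE.
  rewrite -mulr_suml ler_pdivrMr ?exprn_gt0// mul1r rhoE -lee_fin.
  by rewrite -kappa_diag; exact: fset_le_esum.
have vw (A : {fset L}) : rnorm (\sum_(l <- A) b l *: tf l) ^+ 2 <= \sum_(l <- A) w l.
  set S := \sum_(l <- A) b l *: tf l.
  (* AM-GM, with half of the right-hand side absorbed on the left *)
  have h1 : rnorm S ^+ 2 <= \sum_(l <- A) rnorm (b l) * (rnorm (Ts l S) * rnorm f).
    rewrite -[leLHS]/(complex.Re (rnorm S ^+ 2)%:C) -(dot_rnorm dtE) {1}/S dot_suml raddf_sum.
    apply: ler_sum => l _; rewrite dotZl (dotC dt) -(proj1 (tfP l)).
    apply: le_trans (le_Re_rnorm _) _; rewrite rnormM rnormJ ler_wpM2l ?rnorm_ge0//.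
    exact: dot_cauchy_schwarz dtE _ _.
  have h2 : \sum_(l <- A) rnorm (Ts l S) ^+ 2 <= rnorm S ^+ 2.
    rewrite -lee_fin (norm_shift_adj S).
    apply: le_trans (fset_le_esum (fun l => rnorm (Ts l S) ^+ 2) A) _.
    by rewrite leeDr// lee_fin sqr_ge0.
  have h3 : \sum_(l <- A) rnorm (b l) * (rnorm (Ts l S) * rnorm f) <=
      (\sum_(l <- A) w l + \sum_(l <- A) rnorm (Ts l S) ^+ 2) / 2.
    rewrite -big_split mulr_suml; apply: ler_sum => l _; rewrite /w.
    have gen (p q r : R) : p * (q * r) <= (p ^+ 2 * r ^+ 2 + q ^+ 2) / 2.
      by have := sqr_ge0 (p * r - q); nra.
    exact: gen.
  lra.
have [g hg] := has_sum_sqr_le w0 wW vw; exists g; split.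
  move=> y; rewrite -dot_kernel_at.
  have hs := @has_sum_dot _ _ dt dtE _ _ _ (kernel_at y) hg.
  apply: (has_sum_unique hs).
  have := @has_sumZ _ C^o _ _ _ (rho%:C^-1 * ev f y) (@kappaP y x).
  rewrite (_ : (fun l => _) = fun l => dt (b l *: tf l) (kernel_at y)).
    rewrite (_ : _ *: _ = psi y * ev f y)//.
    by rewrite /psi -[_ *: _]/(_ * _); ring.
  apply/funext => l; rewrite dotZl dot_kernel_at (proj2 (tfP l)) /b.
  by rewrite -[_ *: _]/(_ * _) scC; ring.
apply: (has_sum_rnorm_le hg) => A.
rewrite -(@ler_pXn2r _ 2) ?nnegrE ?rnorm_ge0//; exact: le_trans (vw A) (wW A).
Qed.

Let P f : H := sval (cid (psi_contraction f)).

Lemma ev_mul_psi f y : ev (P f) y = psi y * ev f y.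
Proof. by rewrite /P; case: cid => g []. Qed.

Lemma rnorm_mul_psi f : rnorm (P f) <= rnorm f.
Proof. by rewrite /P; case: cid => g []. Qed.

Lemma mul_psi_linear (z : C) f g : P (z *: f + g) = z *: P f + P g.
Proof. by apply: ev_inj => y; rewrite evP !ev_mul_psi evP; ring. Qed.

Variable t : R.
Hypotheses (t_ge0 : 0 <= t) (t_lt1 : t < 1).
Let phi y := (t%:C - psi y) / (1 - t%:C * psi y).

(** If [g - t P g = f], the product is [t g - P g], and [|g - t P g|^2 - |t g - P g|^2 = (1 - t^2)
    (|g|^2 - |P g|^2)] is nonnegative. *)
Lemma moebius_contraction f : exists g,
  (forall y, ev g y = phi y * ev f y) /\ rnorm g <= rnorm f.
Proof.
have sol h : exists g, g - t%:C *: P g = h.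
  exact: neumann t_ge0 t_lt1 mul_psi_linear rnorm_mul_psi.
have evs h g y : g - t%:C *: P g = h -> (1 - t%:C * psi y) * ev g y = ev h y.
  by move=> <-; rewrite evB evZ ev_mul_psi; ring.
(* Solving for the constant function [e 0] gives a [g] with [(1 - t psi) g = 1] pointwise, so the
   denominator has no zero. *)
have nz y : 1 - t%:C * psi y != 0.
  have [g hg] := sol (e 0); have := evs _ _ y hg; rewrite ev_e0.
  by move=> /eqP; apply: contraTneq => ->; rewrite mul0r eq_sym oner_eq0.
have [g hg] := sol f; exists (t%:C *: g - P g); split.
  move=> y; rewrite evB evZ ev_mul_psi /phi -(evs _ _ y hg).
  by rewrite mulrA divfK//; ring.
rewrite -(@ler_pXn2r _ 2) ?nnegrE ?rnorm_ge0// -hg !(rnormBsqr dtE).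
rewrite dotZl dotZr conjCR !rnormZ rnorm_real ger0_norm//.
have hP : rnorm (P g) ^+ 2 <= rnorm g ^+ 2.
  by rewrite ler_pXn2r ?nnegrE ?rnorm_ge0 ?rnorm_mul_psi.
have : 0 <= (1 - t ^+ 2) * (rnorm g ^+ 2 - rnorm (P g) ^+ 2).
  by rewrite mulr_ge0 ?subr_ge0// expr_le1// ltW.
rewrite !exprMn; lra.
Qed.

Lemma moebius_multiplier : multiplier H phi /\ multiplier_norm H phi <= 1.
Proof.
have mE f : ev (mulop phi f : H) = fun y => phi y * ev f y.
  have [g [gE _]] := moebius_contraction f.
  rewrite /mulop; set S := [set _ | _].
  by apply: (@xgetPex _ 0 S); exists g; rewrite /S/=; exact/funext.
have mB f : rnorm (mulop phi f : H) <= rnorm f.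
  have [g [gE gf]] := moebius_contraction f.
  by rewrite (_ : mulop phi f = g)//; apply: ev_inj => y; rewrite mE gE.
split; first by split => //; exists 1 => f; rewrite mul1r.
apply: ge_sup.
  by exists (rnorm (mulop phi (0 : H) : H)); exists 0 => //=; rewrite rnorm0.
by move=> _ [f /= f1 <-]; exact: le_trans (mB f) f1.
Qed.

End Converse.

(** * Points where the Bohr inequality fails *)

Lemma bohr_le_kernel x : bohr_set e x -> k x x <= 9%:R / 8%:R.
Proof.
move=> bx; rewrite kernel_le_kappa_le leNgt.
apply/negP => kx; set K := complex.Re (kappa x x) in kx.
have kxE : kappa x x = K%:C by rewrite /K kappaE.
have K1 : K < 1.
  have := kernel_norm_ge1 x.
  rewrite /K kappaE /= => h.
  by rewrite gtrBl invr_gt0 (lt_le_trans ltr01).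
pose rho := Num.sqrt K.
have rhoE : rho ^+ 2 = K by rewrite sqr_sqrtr//; lra.
have rho_ge0 : 0 <= rho by exact: sqrtr_ge0.
have rho3 : 3%:R^-1 < rho.
  by rewrite -(@ltr_pXn2r _ 2) ?nnegrE ?invr_ge0// rhoE exprVn -natrX.
have rho1 : rho < 1 by rewrite -(@ltr_pXn2r _ 2) ?nnegrE// rhoE expr1n.
have rho_gt0 : 0 < rho by lra.
(* The Bohr inequality will reduce to [rho + 2 rho t <= 1]; this [t] makes the left side
   [(3 rho + 1) / 2], which exceeds 1 because [rho > 1/3]. *)
pose t := 1 - (3%:R * rho - 1) / (4%:R * rho).
have tE : rho * t = rho - (3%:R * rho - 1) / 4%:R.
  by rewrite /t; field; rewrite gt_eqF.
have t0 : 0 <= t by rewrite subr_ge0 ler_pdivrMr ?mulr_gt0//; lra.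
have t1 : t < 1 by rewrite gtrBl divr_gt0 ?mulr_gt0//; lra.
clearbody t.
have [phiM phi1] := moebius_multiplier rho_gt0 rhoE t0 t1.
set phi := (X in multiplier _ X) in phiM phi1.
have [x0 e0E] := e0_kernel.
have evp : ev (mulop phi (e 0)) = phi.
  by rewrite (proj1 phiM); apply/funext => y; rewrite ev_e0 mulr1.
have := le_trans (majorant_ge x e0E evp) (bx _ phiM).
rewrite lee_fin => /le_trans/(_ phi1).
(* [k x0 x = 1] in [k = 1 + kappa k] forces [kappa x0 x = 0], so the value of [phi] at [x0] is
   [t]. *)
have psi0 : kappa x0 x = 0.
  have k1 : k x0 x = 1 by rewrite kernel_sym -ev_kernel_at -e0E ev_e0 conjC1.
  have := kernelE x0 x; rewrite k1 mulr1 => /(congr1 (fun z => z - 1)).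
  by rewrite subrr addrAC subrr add0r.
have phi0E : phi x0 = t%:C by rewrite /phi psi0 mul0r mulr0 !subr0 divr1.
have phixE : phi x = ((t - rho) / (1 - t * rho))%:C.
  rewrite /phi kxE -rhoE.
  have -> : (rho ^+ 2)%:C / rho%:C = rho%:C :> C.
    by rewrite expr2 realCM mulfK// (inj_eq (@complexI R) _ 0) gt_eqF.
  by rewrite [RHS](fmorph_div (real_complex R)) !(rmorphB (real_complex R))
     (rmorphM (real_complex R)) rmorph1.
rewrite phixE phi0E -rmorphB !rnorm_real (ger0_norm t0).
have d0 : 0 < 1 - t * rho by have := mulr_ge0 t0 rho_ge0; nra.
have -> : (t - rho) / (1 - t * rho) - t = - (rho * (1 - t ^+ 2) / (1 - t * rho)).
  by field; rewrite gt_eqF.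
have t2 : 0 <= rho * (1 - t ^+ 2) by rewrite mulr_ge0// subr_ge0 expr_le1// ltW.
rewrite normrN ger0_norm ?divr_ge0 ?(ltW d0)// -lerBrDl ler_pdivrMr//.
(* Cancelling [1 - t] leaves [rho (1 + t) <= 1 - t rho]. *)
have -> : rho * (1 - t ^+ 2) = (1 - t) * (rho * (1 + t)) by ring.
rewrite ler_pM2l ?subr_gt0// => h.
have : rho + 2 * (rho * t) <= 1 by lra.
rewrite tE; lra.
Qed.

End Admissible.

Theorem theorem1 (R : realType) (X : Type) (H : rkhs R X)
    (L : countNmodType) (e : L -> H)
    (He : admissible e) (Hk : diagonal_complete_pick e) :
  bohr_set e = [set x : X | rk_kernel H x x <= 9%:R / 8%:R :> R[i]].
Proof.
case: Hk => _ [kappa [c [c_ge0 kP]]].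
(* The signs of [c] are known only off 0; the value 0 there lets every sum run over all of [L]. *)
pose c' l := if l == 0 then 0 else c l.
have c'_ge0 l : 0 <= c' l by rewrite /c'; case: eqVneq => // /c_ge0.
have kappaP x y : has_sum predT (fun l =>
    (c' l)%:C * rk_eval H (e l) x * (rk_eval H (e l) y)^* : R[i]^o) (kappa x y).
  have [_ + _] := kP x y; rewrite /has_sum.
  rewrite (_ : (fun A : {fset L} => _) = fun A : {fset L} => \sum_(l <- A)
    ((c' l)%:C * rk_eval H (e l) x * (rk_eval H (e l) y)^* : R[i]^o))//.
  apply/funext => A; rewrite big_mkcond/=; apply: eq_bigr => l _.
  by rewrite /c'; case: eqVneq => //= _; rewrite !mul0r.
have kernelE x y : rk_kernel H x y = 1 + kappa x y * rk_kernel H x y.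
  by case: (kP x y).
apply/seteqP; split=> x /=.
  exact: (bohr_le_kernel He c'_ge0 kappaP kernelE).
exact: (le_kernel_bohr He c'_ge0 kappaP kernelE).
Qed.
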